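(* Let $\alpha>0$ and $T>0$. Let $e_N=\widehat X^N_{N,1}-X^1_T$ be the error of the PC(EM-BEM) method with step-size $h=T/N$ for the linear stochastic oscillator. Then, as $N\to\infty$, $$\mathrm{Var}(e_N)=\alpha^2\Big(\frac{T^3}{24}-\frac{T^2\sin(2T)}{16}+\frac{6\cos^2(T)+5}{48}T+\frac{5\sin(2T)}{96}\Big)h^2+\mathcal{O}(h^3),$$ and $Ne_N-\mathbb{E}[Ne_N]$ converges in distribution to $$\mathcal{N}\Big(0,\alpha^2T^2\Big(\frac{T^3}{24}-\frac{T^2\sin(2T)}{16}+\frac{6\cos^2(T)+5}{48}T+\frac{5\sin(2T)}{96}\Big)\Big).$$
   Context: Linear stochastic oscillator: $\mathrm{d}X_t=\begin{pmatrix}0&1\\-1&0\end{pmatrix}X_t\,\mathrm{d}t+\alpha\begin{pmatrix}0\\1\end{pmatrix}\mathrm{d}W_t$, $t\in[0,T]$, $X_t=(X^1_t,X^2_t)^\top$, with deterministic $X_0=(X^1_0,X^2_0)^\top\in\mathbb{R}^2$ and $W$ a one-dimensional standard Brownian motion. The PC(EM-BEM) method (predictor–corrector with Euler–Maruyama predictor and backward Euler–Maruyama corrector) is $(\widehat X^N_{k+1,1},\widehat X^N_{k+1,2})^\top=A(\widehat X^N_{k,1},\widehat X^N_{k,2})^\top+\alpha b(W_{(k+1)h}-W_{kh})$, $k=0,\dots,N-1$, $(\widehat X^N_{0,1},\widehat X^N_{0,2})^\top=X_0$, with $h=T/N$ and $A=\begin{pmatrix}1-h^2&h\\-h&1-h^2\end{pmatrix}$,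 $b=\begin{pmatrix}h\\1\end{pmatrix}$. $\mathcal{O}(h^3)$ denotes a quantity bounded by $Ch^3$ for all sufficiently small $h$, with $C$ independent of $h$ ($T,\alpha$ fixed). $\mathcal{N}(\mathbf m,\Sigma)$ is the normal law with mean $\mathbf m$ and variance $\Sigma$. *)

(* Defs.v *)
From HB Require Import structures.
From mathcomp Require Import all_boot all_order all_algebra.
From mathcomp Require Import all_classical all_reals all_analysis.

Set Implicit Arguments.
Unset Strict Implicit.
Unset Printing Implicit Defensive.

Import Order.TTheory GRing.Theory Num.Theory.
Import numFieldNormedType.Exports.

Local Open Scope classical_set_scope.
Local Open Scope ring_scope.

Section Probability.
Context {d : measure_display} {Omega : measurableType d} {R : realType}.
Variable P : probability Omega R.

(* Since the family is finite and the sets B i may be taken to be setT, the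
   product rule for the whole family contains that for every subfamily. *)
Definition mutually_independent n (X : 'I_n -> Omega -> R) :=
  forall B : 'I_n -> set R, (forall i, measurable (B i)) ->
    P (\bigcap_(i in [set: 'I_n]) (X i @^-1` B i))
    = (\prod_(i < n) P (X i @^-1` B i))%E.

(* The law of the increments is only prescribed for s < t, because
   normal_prob m 0 is not the Dirac mass at m. The last argument of normal_prob
   is the standard deviation. *)
Record is_brownian_motion (W : R -> {RV P >-> R}) : Prop := {
  brownian_start : {ae P, forall w, W 0 w = 0};
  brownian_independent_increments : forall n (t : nat -> R),
    0 <= t 0%N -> (forall i, t i <= t i.+1) ->
    mutually_independent
      (fun (i : 'I_n) (w : Omega) => W (t i.+1) w - W (t i) w);
  brownian_increment_law : forall s t : R, 0 <= s -> s < t ->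
    forall B : set R, measurable B ->
      P ((fun w => W t w - W s w) @^-1` B)
      = normal_prob 0 (Num.sqrt (t - s)) B;
  brownian_continuous :
    {ae P, forall w, {within `[0, +oo[, continuous (fun t => W t w)}}
}.

Definition cvg_in_distribution (Y : nat -> Omega -> R)
    (mu : probability (measurableTypeR R) R) :=
  (forall n, measurable_fun [set: Omega] (Y n)) /\
  (forall f : R -> R, continuous f -> [bounded f x | x in [set: R]] ->
     'E_P[f \o Y n]%E @[n --> \oo] --> (\int[mu]_x (f x)%:E)%E).

End Probability.

Section Oscillator.
Context {R : realType}.

Definition mx2 (a b c e : R) : 'M[R]_2 :=
  \matrix_(i, j) (if i == 0 then (if j == 0 then a else b)
                  else (if j == 0 then c else e)).

Definition cv2 (a b : R) : 'cV[R]_2 := \col_i (if i == 0 then a else b).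

Definition oscillator_drift : 'M[R]_2 := mx2 0 1 (-1) 0.

Definition oscillator_noise : 'cV[R]_2 := cv2 0 1.

Context {d : measure_display} {Omega : measurableType d}.
Variable P : probability Omega R.

(* The SDE in integral form. The diffusion coefficient is constant, so the
   stochastic integral of it over [0, t] is alpha * (W_t - W_0) *: (0, 1)^T,
   and the drift term is a pathwise integral of a continuous function. *)
Record is_oscillator_solution (alpha T : R) (x0 : 'cV[R]_2)
    (W : R -> {RV P >-> R}) (X : R -> Omega -> 'cV[R]_2) : Prop := {
  oscillator_measurable : forall (t : R) (i : 'I_2), 0 <= t <= T ->
    measurable_fun [set: Omega] (fun w => X t w i 0);
  oscillator_continuous : {ae P, forall w, forall i : 'I_2,
    {within `[0, T], continuous (fun t => X t w i 0)}};
  oscillator_equation : {ae P, forall w, forall (t : R) (i : 'I_2),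
    0 <= t <= T ->
    X t w i 0 =
      x0 i 0
      + Rintegral (@lebesgue_measure R) `[0, t]
          (fun s => (oscillator_drift *m X s w) i 0)
      + (alpha * (W t w - W 0 w)) * oscillator_noise i 0}
}.

(* With J the drift matrix and D = alpha *: (0, dW)^T, one step is the predictor
   Y = x + h J x + D followed by the corrector x + h J Y + D, that is
   (1 + h J + h^2 J^2) x + (1 + h J) D. *)
Definition pc_matrix (h : R) : 'M[R]_2 := mx2 (1 - h ^+ 2) h (- h) (1 - h ^+ 2).

Definition pc_noise (h : R) : 'cV[R]_2 := cv2 h 1.

Fixpoint pc_em_bem (alpha h : R) (x0 : 'cV[R]_2) (W : R -> {RV P >-> R})
    (k : nat) (w : Omega) : 'cV[R]_2 :=
  if k is k'.+1 then
    pc_matrix h *m pc_em_bem alpha h x0 W k' w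
    + (alpha * (W (k'.+1%:R * h) w - W (k'%:R * h) w)) *: pc_noise h
  else x0.

Definition pc_error (alpha T : R) (x0 : 'cV[R]_2) (W : R -> {RV P >-> R})
    (X : R -> Omega -> 'cV[R]_2) (N : nat) (w : Omega) : R :=
  pc_em_bem alpha (T / N%:R) x0 W N w 0 0 - X T w 0 0.

End Oscillator.

(* Equal to the integral over [0, T] of
   (cos t)^2 / 3 - t sin t cos t / 2 + t^2 (sin t)^2 / 4,
   hence positive for T > 0. *)
Definition error_constant {R : realType} (T : R) : R :=
  T ^+ 3 / 24 - T ^+ 2 * sin (2 * T) / 16
  + (6 * cos T ^+ 2 + 5) / 48 * T + 5 * sin (2 * T) / 96.

(* Main.v *)
(** The solution satisfies X^1_T = x0_1 cos T + x0_2 sin T + alpha * int_0^T sin (T - t) dW_t,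
    and the scheme gives the same expression with sin (T - t) replaced by the step
    function c_n, the first coordinate of A^n b, on the step where T - t lies between
    n h and (n + 1) h. So the centred error is the Wiener integral of c_n - sin (T - t), a
    centred Gaussian variable of variance
    alpha^2 * sum_n int_(n h)^((n + 1) h) (c_n - sin s)^2 ds.
    With tau = n h one has
    c_n = (1 - h tau / 2) (h cos tau + sin tau) + O(h^2), hence
    c_n - sin (tau + u) = (h - u) cos tau - (h tau / 2) sin tau + O(h^2),
    whose square integrates over 0 <= u <= h to h^3 * error_density tau + O(h^4), and
    error_constant is the integral of error_density.

    No stochastic integral is needed: for almost every path the Riemann-Stieltjes sums of
    sin (T - t) against W on finer and finer grids converge to the required limit, because
    the paths are uniformly continuous. These sums are Gaussian as sums of independent
    Gaussian increments, and Gaussian laws are closed under limits. *)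

From HB Require Import structures.
Require Import Defs.
From mathcomp Require Import all_boot all_order all_algebra.
From mathcomp Require Import all_classical all_reals all_analysis.
From mathcomp Require Import ring lra measurable_realfun.
Import Order.TTheory GRing.Theory Num.Theory.
Import numFieldNormedType.Exports.
Local Open Scope classical_set_scope.
Local Open Scope ring_scope.

(** * Taylor estimates and the coefficients of the scheme *)

(** The error is exactly Gaussian for every N > 0, so no central limit theorem enters: both claims
    reduce to the expansion of one explicit variance. Its leading term has order h^2, so c_n - sin
    must be known up to O(h^2). About T / h one-step defects accumulate, hence each must be O(h^3).
    This forces the damping in [pc_approx]: [pc_matrix h] has determinant 1 - h^2 + h^4, so it
    contracts by about 1 - h^2 / 2 per step, that is by about 1 - h tau / 2 up to time tau. The
    damping produces the sin tau term of the residual and with it the T^3 / 24 of the constant.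

    Degenerate laws are the obstacle on the probabilistic side: partial sums and limits may have
    variance 0, where [normal_prob] is useless. Gaussian laws are therefore images of the standard
    one under multiplication by s, and the translation to [normal_prob 0 s] is made only for s > 0,
    at the increments of W and at the limit law. There the strict positivity of [error_constant] is
    essential. *)

Section PointwiseDerivatives.
Context {R : realType}.
Implicit Types (f g : R -> R) (x a b c : R).

Lemma is_derive_pt_cst x c : is_derive x 1 (fun _ : R => c) 0.
Proof. exact: is_derive_cst. Qed.

Lemma is_derive_pt_id x : is_derive x 1 (fun y : R => y) 1.
Proof. exact: is_derive_id. Qed.

Lemma is_derive_ptD f g x a b : is_derive x 1 f a -> is_derive x 1 g b ->
  is_derive x 1 (fun y => f y + g y) (a + b).
Proof. by move=> ? ?; exact: is_deriveD. Qed.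

Lemma is_derive_ptN f x a : is_derive x 1 f a ->
  is_derive x 1 (fun y => - f y) (- a).
Proof. by move=> ?; exact: is_deriveN. Qed.

Lemma is_derive_ptM f g x a b : is_derive x 1 f a -> is_derive x 1 g b ->
  is_derive x 1 (fun y => f y * g y) (f x * b + g x * a).
Proof. by move=> ? ?; exact: is_deriveM. Qed.

Lemma is_derive_ptX f x a n : is_derive x 1 f a ->
  is_derive x 1 (fun y => f y ^+ n.+1) (n.+1%:R * f x ^+ n * a).
Proof.
move=> fa; have -> : (fun y => f y ^+ n.+1) = f ^+ n.+1 by rewrite exprfctE.
exact: (@is_deriveX _ _ f n.+1 x 1 a fa).
Qed.

Lemma is_derive_pt_sin f x a : is_derive x 1 f a ->
  is_derive x 1 (fun y => sin (f y)) (cos (f x) * a).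
Proof.
by move=> ?; apply: (@is_derive1_comp _ sin f); exact: is_derive_sin.
Qed.

Lemma is_derive_pt_cos f x a : is_derive x 1 f a ->
  is_derive x 1 (fun y => cos (f y)) (- sin (f x) * a).
Proof.
by move=> ?; apply: (@is_derive1_comp _ cos f); exact: is_derive_cos.
Qed.

Lemma is_derive_pt_expR f x a : is_derive x 1 f a ->
  is_derive x 1 (fun y => expR (f y)) (expR (f x) * a).
Proof.
by move=> ?; apply: (@is_derive1_comp _ expR f); exact: is_derive_expR.
Qed.

Lemma is_derive_within_continuous f (df : R -> R) a b :
  (forall x : R, is_derive x 1 f (df x)) -> {within `[a, b], continuous f}.
Proof.
move=> fdf; apply: continuous_subspaceT => x.
by apply/differentiable_continuous/derivable1_diffP; have [] := fdf x.
Qed.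

Lemma derive_mean_value f (df : R -> R) a b : a <= b ->
  (forall x : R, is_derive x 1 f (df x)) ->
  exists2 c, a <= c <= b & f b - f a = df c * (b - a).
Proof.
move=> ab fdf.
have [c cab fE] := @MVT_segment R f df a b ab (fun x _ => fdf x)
  (is_derive_within_continuous f df a b fdf).
by exists c => //; move: cab; rewrite in_itv.
Qed.

Lemma derive_norm_le f (df : R -> R) a b L : a <= b ->
  (forall x : R, is_derive x 1 f (df x)) ->
  (forall x, a <= x <= b -> `|df x| <= L) ->
  `|f b - f a| <= L * (b - a).
Proof.
move=> ab fdf dfL.
have [c cab ->] := derive_mean_value f df a b ab fdf.
by rewrite normrM (ger0_norm (_ : 0 <= b - a)) ?subr_ge0// ler_wpM2r ?subr_ge0// dfL.
Qed.

End PointwiseDerivatives.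

(* [apply:] would solve the premises with the library instances, whose
   derivatives are stated with [*:], which [ring] does not interpret. *)
Ltac pointwise_derive :=
  notypeclasses refine (is_derive_eq _ _); first (repeat first
    [ notypeclasses refine (is_derive_pt_cst _ _)
    | notypeclasses refine (is_derive_pt_id _)
    | notypeclasses refine (is_derive_ptD _ _ _ _ _ _ _)
    | notypeclasses refine (is_derive_ptN _ _ _ _)
    | notypeclasses refine (is_derive_ptX _ _ _ _ _)
    | notypeclasses refine (is_derive_ptM _ _ _ _ _ _ _)
    | notypeclasses refine (is_derive_pt_sin _ _ _ _)
    | notypeclasses refine (is_derive_pt_cos _ _ _ _)
    | notypeclasses refine (is_derive_pt_expR _ _ _ _) ]); rewrite /=.

Section TrigTaylor.
Context {R : realType}.
Implicit Types u : R.

Lemma sin_le_id u : 0 <= u -> `|sin u| <= u.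
Proof.
move=> u0.
have := derive_norm_le sin cos 0 u 1 u0 (is_derive_sin (R:=R)) (fun x _ => cos_max x).
by rewrite sin0 !subr0 mul1r.
Qed.

(** Each estimate of this section bounds the derivative occurring in the next one. The mean value
    inequality loses the factorials, which is harmless because only the orders matter. *)
Lemma cos_taylor0 u : 0 <= u <= 1 -> `|cos u - 1| <= u ^+ 2.
Proof.
move=> /andP[u0 u1].
have H : forall x, 0 <= x <= u -> `|- sin x| <= u.
  by move=> x /andP[x0 xu]; rewrite normrN (le_trans (sin_le_id _ x0)).
have := derive_norm_le cos (fun x => - sin x) 0 u u u0 (is_derive_cos (R:=R)) H.
by rewrite cos0 subr0 expr2.
Qed.

Lemma sin_taylor1 u : 0 <= u <= 1 -> `|sin u - u| <= u ^+ 3.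
Proof.
move=> /andP[u0 u1].
have H1 : forall x : R, is_derive x 1 (fun y : R => sin y - y) (cos x - 1).
  by move=> x; pointwise_derive; ring.
have H : forall x, 0 <= x <= u -> `|cos x - 1| <= u ^+ 2.
  move=> x /andP[x0 xu]; apply: (le_trans (cos_taylor0 _ _)); first lra.
  by rewrite ler_sqr ?nnegrE.
have := derive_norm_le _ _ 0 u _ u0 H1 H.
by rewrite sin0 !subr0 -exprSr.
Qed.

Lemma cos_taylor2 u : 0 <= u <= 1 -> `|cos u - (1 - u ^+ 2 / 2)| <= u ^+ 3.
Proof.
move=> /andP[u0 u1].
have H1 : forall x : R, is_derive x 1 (fun y : R => cos y - (1 - y ^+ 2 / 2)) (x - sin x).
  by move=> x; pointwise_derive; field.
have H : forall x, 0 <= x <= u -> `|x - sin x| <= u ^+ 2.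
  move=> x /andP[x0 xu]; rewrite distrC; apply: (le_trans (sin_taylor1 _ _)); first lra.
  apply: (@le_trans _ _ (x ^+ 2)); last by rewrite ler_sqr ?nnegrE.
  by rewrite exprSr ler_piMr ?sqr_ge0//; lra.
have := derive_norm_le _ _ 0 u _ u0 H1 H.
rewrite cos0 expr0n /= mul0r !subr0 subrr subr0 -exprSr //.
Qed.

End TrigTaylor.

(** * The leading constant and its density *)

Section ErrorConstant.
Context {R : realType}.
Implicit Types t : R.

Definition error_density t :=
  cos t ^+ 2 / 3 - t * sin t * cos t / 2 + t ^+ 2 * sin t ^+ 2 / 4.

Lemma is_derive_error_constant t :
  is_derive t 1 error_constant (error_density t).
Proof.
rewrite /error_constant /error_density; pointwise_derive.
have -> : 2 * t = t *+ 2 by rewrite mulr_natl.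
rewrite sin_mulr2n cos_mulr2n sin2cos2.
by field.
Qed.

(** Completing the square leaves c^2 / 12, which vanishes only where cos t = 0. There t is nonzero
    since cos 0 = 1, and sin t is nonzero, so the square itself is positive. *)
Lemma error_density_gt0 t : 0 < error_density t.
Proof.
rewrite /error_density; have := cos2Dsin2 t.
set c := cos t; set s := sin t => cs.
have -> : c ^+ 2 / 3 - t * s * c / 2 + t ^+ 2 * s ^+ 2 / 4 =
  (t * s / 2 - c / 2) ^+ 2 + c ^+ 2 / 12 by field.
have [c0|c0] := eqVneq c 0; last first.
  by rewrite ltr_wpDl ?sqr_ge0// divr_gt0// exprn_even_gt0.
have t0 : t != 0.
  by apply/eqP => t0; move/eqP: c0; rewrite /c t0 cos0 oner_eq0.
have s0 : s != 0.
  by apply/eqP => s0; move: cs; rewrite c0 s0 expr0n addr0 => /esym/eqP; rewrite oner_eq0.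
by rewrite c0 mul0r subr0 expr0n mul0r addr0 exprn_even_gt0//= !mulf_neq0// invr_eq0 pnatr_eq0.
Qed.

Lemma error_constant_gt0 (T : R) : 0 < T -> 0 < error_constant T.
Proof.
move=> T0.
have [c _] := derive_mean_value _ _ 0 T (ltW T0) is_derive_error_constant.
have -> : error_constant (0 : R) = 0.
  by rewrite /error_constant !(mulr0, mul0r, sin0, addr0, subr0, expr0n).
rewrite !subr0 => ->.
by rewrite mulr_gt0// error_density_gt0.
Qed.

Lemma ler_normM (x y a b : R) : `|x| <= a -> `|y| <= b -> `|x * y| <= a * b.
Proof. by move=> xa yb; rewrite normrM ler_pM. Qed.

(** Serves to move the density from a mean value point of a cell to the left end of that cell. *)
Lemma error_density_lipschitz (T s t : R) : 0 <= s -> s <= t -> t <= T ->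
  `|error_density t - error_density s| <= (2 + T + T ^+ 2) * (t - s).
Proof.
move=> s0 st tT.
pose D x : R := - (sin x * cos x) * (7 / 6) + x * (2 * sin x ^+ 2 - cos x ^+ 2) / 2
  + x ^+ 2 * (sin x * cos x) / 2.
have dD : forall x : R, is_derive x 1 error_density (D x).
  by move=> x; rewrite /error_density /D; pointwise_derive; field.
apply: (derive_norm_le _ D) => // x /andP[sx xt].
have x0 : 0 <= x by lra.
have xT : x <= T by lra.
have p1 : `|sin x * cos x| <= 1 * 1 by apply: ler_normM; [exact: sin_max|exact: cos_max].
have p2 : `|x * (2 * sin x ^+ 2 - cos x ^+ 2)| <= T * 2.
  apply: ler_normM; first by rewrite ger0_norm.
  have := sqr_ge0 (sin x); have := sqr_ge0 (cos x); have := cos2Dsin2 x.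
  by move=> ? ? ?; rewrite ler_norml; apply/andP; split; lra.
have p3 : `|x ^+ 2 * (sin x * cos x)| <= T ^+ 2 * (1 * 1).
  apply: ler_normM => //; rewrite ger0_norm ?sqr_ge0// ler_sqr ?nnegrE//; lra.
move: p1 p2 p3; rewrite /D !ler_norml => /andP[? ?] /andP[? ?] /andP[? ?].
have := sqr_ge0 T; move=> ?.
by apply/andP; split; lra.
Qed.

End ErrorConstant.

(** * Accuracy of the damped rotation *)

Section PredictorCorrectorCoefficients.
Context {R : realType}.
Implicit Types (h T tau u v : R) (n : nat).

Fixpoint pc_coef h n : R * R :=
  if n is n'.+1 then
    let: (p, q) := pc_coef h n' in
    ((1 - h ^+ 2) * p + h * q, - h * p + (1 - h ^+ 2) * q)
  else (h, 1).

(* The rotation by tau applied to pc_noise h, damped: pc_matrix h agrees up to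
   O(h^3) with the rotation by h times 1 - h^2 / 2. *)
Definition pc_approx h tau : R * R :=
  ((1 - h * tau / 2) * (h * cos tau + sin tau),
   (1 - h * tau / 2) * (cos tau - h * sin tau)).

(** The quantity bounded is the one-step defect of [pc_approx] after substituting cos h = 1 - h^2 /
    2 + k and sin h = h + s. The terms of order h^2 have cancelled against the increase of the
    damping; what remains carries an explicit h^3 or a Taylor remainder. *)
Lemma pc_local_bound h T tau u v (k s : R) : 0 < h <= 1 -> 0 <= tau <= T ->
  `|u| <= 2 -> `|v| <= 2 -> `|k| <= h ^+ 3 -> `|s| <= h ^+ 3 ->
  `|h ^+ 3 * (u * (tau / 4 - h / 4) + v / 2)
    - (1 - h * tau / 2 - h ^+ 2 / 2) * (u * k + v * s)|
  <= 10 * (1 + T) * h ^+ 3.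
Proof.
move=> /andP[h0 h1] /andP[t0 tT] u2 v2 kh sh.
have h3 : 0 <= h ^+ 3 by rewrite exprn_ge0// ltW.
have htau : 0 <= h * tau <= T.
  by rewrite mulr_ge0 ?(ltW h0)//= (le_trans _ tT)// ler_piMl.
have hh : 0 <= h ^+ 2 <= 1 by rewrite sqr_ge0/= expr_le1// ltW.
have B1 : `|u * (tau / 4 - h / 4) + v / 2| <= 2 * (T / 4 + 1 / 4) + 1.
  apply: (le_trans (ler_normD _ _)); apply: lerD.
    by apply: ler_normM => //; rewrite ler_norml; apply/andP; split; lra.
  by move: v2; rewrite !ler_norml => /andP[? ?]; apply/andP; split; lra.
have B2 : `|1 - h * tau / 2 - h ^+ 2 / 2| <= 2 + T.
  by move: htau hh => /andP[? ?] /andP[? ?]; rewrite ler_norml; apply/andP; split; lra.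
have B3 : `|u * k + v * s| <= 4 * h ^+ 3.
  apply: (le_trans (ler_normD _ _)).
  have -> : 4 * h ^+ 3 = 2 * h ^+ 3 + 2 * h ^+ 3 by ring.
  by apply: lerD; apply: ler_normM.
have B4 := ler_normM _ _ _ _ B2 B3.
have B5 : `|h ^+ 3 * (u * (tau / 4 - h / 4) + v / 2)| <=
    h ^+ 3 * (2 * (T / 4 + 1 / 4) + 1).
  by apply: ler_normM => //; rewrite ger0_norm.
apply: (le_trans (ler_normB _ _)); apply: (le_trans (lerD B5 B4)).
have T0 : 0 <= T * h ^+ 3 by rewrite mulr_ge0//; lra.
lra.
Qed.

Lemma pc_approx_step h T tau : 0 < h <= 1 -> 0 <= tau <= T ->
  let p := (pc_approx h tau).1 in let q := (pc_approx h tau).2 in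
  `|(1 - h ^+ 2) * p + h * q - (pc_approx h (tau + h)).1|
  + `|- h * p + (1 - h ^+ 2) * q - (pc_approx h (tau + h)).2|
  <= 20 * (1 + T) * h ^+ 3.
Proof.
move=> h01 tT /=; have /andP[h0 h1] := h01.
have h01' : 0 <= h <= 1 by lra.
pose k := cos h - (1 - h ^+ 2 / 2); pose s := sin h - h.
pose u := h * cos tau + sin tau; pose v := cos tau - h * sin tau.
have cE : cos h = 1 - h ^+ 2 / 2 + k by rewrite /k; ring.
have sE : sin h = h + s by rewrite /s; ring.
have hc := ler_normM h (cos tau) 1 1; have hs := ler_normM h (sin tau) 1 1.
have nh : `|h| <= 1 by rewrite ger0_norm// ltW.
have u2 : `|u| <= 2.
  apply: (le_trans (ler_normD _ _)); apply: (@le_trans _ _ (1 * 1 + 1)); last lra.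
  by apply: lerD; [apply: hc => //; exact: cos_max|exact: sin_max].
have v2 : `|v| <= 2.
  apply: (le_trans (ler_normB _ _)); apply: (@le_trans _ _ (1 + 1 * 1)); last lra.
  by apply: lerD; [exact: cos_max|apply: hs => //; exact: sin_max].
have kh : `|k| <= h ^+ 3 by exact: cos_taylor2.
have sh : `|s| <= h ^+ 3 by exact: sin_taylor1.
rewrite sinD cosD cE sE.
have B1 := pc_local_bound h T tau u v k s h01 tT u2 v2 kh sh.
(* The second coordinate is the first one after a quarter turn, which replaces (u, v) by (v, -
   u). *)
have B2 := pc_local_bound h T tau v (- u) k s h01 tT v2.
rewrite normrN in B2; have {}B2 := B2 u2 kh sh.
have -> : 20 * (1 + T) * h ^+ 3 = 10 * (1 + T) * h ^+ 3 + 10 * (1 + T) * h ^+ 3.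
  by ring.
apply: lerD.
- apply: le_trans B1; rewrite le_eqVlt; apply/orP; left; apply/eqP; congr (`| _ |).
  by rewrite /u /v; field.
- apply: le_trans B2; rewrite le_eqVlt; apply/orP; left; apply/eqP; congr (`| _ |).
  by rewrite /u /v; field.
Qed.

(** Discrete Gronwall argument: in the l1 norm [pc_matrix h] has operator norm at most 1 + h, each
    step adds a defect of at most 20 (1 + T) h^3, and the approximation is exact at n = 0. *)
Lemma pc_coef_error h T n : 0 < h <= 1 -> n%:R * h <= T ->
  `|(pc_coef h n).1 - (pc_approx h (n%:R * h)).1|
  + `|(pc_coef h n).2 - (pc_approx h (n%:R * h)).2|
  <= 20 * (1 + T) * h ^+ 3 * n%:R * (1 + h) ^+ n.
Proof.
move=> h01; have /andP[h0 h1] := h01.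
elim: n => [_|n IH nT].
  by rewrite /= !(mulr0n, mul0r, mulr0, subr0, cos0, sin0, mulr1, addr0, mul1r,
    subrr, normr0).
have E0 : 0 <= 20 * (1 + T) * h ^+ 3.
  have T0 : 0 <= T by apply: le_trans nT; rewrite mulr_ge0// ltW.
  by rewrite mulr_ge0 ?exprn_ge0 ?(ltW h0)//; lra.
have nh0 : 0 <= n%:R * h by rewrite mulr_ge0// ltW.
have tT : 0 <= n%:R * h <= T.
  by rewrite nh0/=; move: nT; rewrite -natr1 mulrDl mul1r => nT; lra.
have /andP[_ tT'] := tT.
have := IH tT'; have := pc_approx_step h T (n%:R * h) h01 tT.
have -> : n%:R * h + h = n.+1%:R * h by rewrite -natr1; ring.
rewrite /=; case: (pc_coef h n) => p q /=.
set P := (pc_approx h (n%:R * h)).1; set Q := (pc_approx h (n%:R * h)).2.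
rewrite -/(pc_approx h (n.+1%:R * h)).
set P' := (X in _ - X); set Q' := (X in _ + `|_ - X|).
move=> loc {}IH.
have h2 : 0 <= h ^+ 2 <= 1 by rewrite sqr_ge0/= expr_le1// ltW.
have n1 : `|1 - h ^+ 2| <= 1.
  by move: h2 => /andP[? ?]; rewrite ler_norml; apply/andP; split; lra.
have nh : `|h| <= h by rewrite ger0_norm// ltW.
set a := p - P in IH *; set b := q - Q in IH *.
have S1 : `|(1 - h ^+ 2) * p + h * q - P'| <=
    `|a| + h * `|b| + `|(1 - h ^+ 2) * P + h * Q - P'|.
  have -> : (1 - h ^+ 2) * p + h * q - P' =
    (1 - h ^+ 2) * a + h * b + ((1 - h ^+ 2) * P + h * Q - P').
    by rewrite /a /b; ring.
  apply: (le_trans (ler_normD _ _)); rewrite lerD2r.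
  apply: (le_trans (ler_normD _ _)); apply: lerD; last exact: ler_normM.
  by rewrite -[leRHS]mul1r; exact: ler_normM.
have S2 : `|- h * p + (1 - h ^+ 2) * q - Q'| <=
    h * `|a| + `|b| + `|- h * P + (1 - h ^+ 2) * Q - Q'|.
  have -> : - h * p + (1 - h ^+ 2) * q - Q' =
    - h * a + (1 - h ^+ 2) * b + (- h * P + (1 - h ^+ 2) * Q - Q').
    by rewrite /a /b; ring.
  apply: (le_trans (ler_normD _ _)); rewrite lerD2r.
  apply: (le_trans (ler_normD _ _)); apply: lerD.
    by apply: ler_normM => //; rewrite normrN.
  by rewrite -[leRHS]mul1r; exact: ler_normM.
apply: (le_trans (lerD S1 S2)).
set E := 20 * (1 + T) * h ^+ 3 in loc E0 IH *.
have -> : E * n.+1%:R * (1 + h) ^+ n.+1 =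
  (1 + h) * (E * n%:R * (1 + h) ^+ n) + E * (1 + h) ^+ n.+1.
  by rewrite -natr1 exprS; ring.
have e1 : E <= E * (1 + h) ^+ n.+1.
  by rewrite ler_peMr// exprn_ege1//; lra.
have := ler_wpM2l (_ : 0 <= 1 + h) IH; rewrite mulrDr => ih.
have {}ih := ih (addr_ge0 ler01 (ltW h0)).
lra.
Qed.

End PredictorCorrectorCoefficients.

(** * Expansion of the variance *)

Section VarianceExpansion.
Context {R : realType}.
Implicit Types (h T tau u c : R) (n N : nat).

Lemma pc_coef_le h T n : 0 < h <= 1 -> n%:R * h <= T ->
  `|(pc_coef h n).1 - (pc_approx h (n%:R * h)).1|
  <= 20 * (1 + T) * T * expR T * h ^+ 2.
Proof.
move=> h01 nT; have /andP[h0 h1] := h01.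
have nh0 : 0 <= n%:R * h by rewrite mulr_ge0// ltW.
have T0 : 0 <= T by apply: le_trans nT.
have := pc_coef_error h T n h01 nT.
move=> H; apply: le_trans (le_trans _ H) _; first by rewrite lerDl.
have e1 : (1 + h) ^+ n <= expR T.
  apply: (@le_trans _ _ (expR h ^+ n)).
    by apply: lerXn2r; rewrite ?nnegrE ?expR_ge0 ?expR_ge1Dx//; lra.
  by rewrite -expRM_natl ler_expR.
have -> : 20 * (1 + T) * h ^+ 3 * n%:R * (1 + h) ^+ n =
  20 * (1 + T) * h ^+ 2 * ((n%:R * h) * (1 + h) ^+ n) by ring.
have -> : 20 * (1 + T) * T * expR T * h ^+ 2 =
  20 * (1 + T) * h ^+ 2 * (T * expR T) by ring.
apply: ler_wpM2l; first by rewrite mulr_ge0 ?sqr_ge0//; lra.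
by apply: ler_pM => //; rewrite exprn_ge0//; lra.
Qed.

Definition residual_lin h tau u : R := (h - u) * cos tau - h * tau / 2 * sin tau.

Lemma pc_coef_residual T : 0 < T -> exists2 C : R, 0 <= C & forall h n u,
  0 < h <= 1 -> n%:R * h <= T -> 0 <= u <= h ->
  `|(pc_coef h n).1 - sin (n%:R * h + u) - residual_lin h (n%:R * h) u|
  <= C * h ^+ 2.
Proof.
move=> T0; set C1 := 20 * (1 + T) * T * expR T.
have C10 : 0 <= C1 by rewrite !mulr_ge0 ?expR_ge0//; lra.
(* [C1] bounds the error of [pc_approx], T / 2 the term of order h^2 in its expanded product, and 2
   the Taylor remainders of cos u and sin u. *)
exists (C1 + T / 2 + 2); first lra.
move=> h n u h01 nT /andP[u0 uh]; have /andP[h0 h1] := h01.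
have := pc_coef_le h T n h01 nT; rewrite -/C1.
have t0 : 0 <= n%:R * h by rewrite mulr_ge0// ltW.
set p := (pc_coef h n).1; set t := n%:R * h in t0 nT *; move=> pP.
have h20 : 0 <= h ^+ 2 by exact: sqr_ge0.
have u2 : u ^+ 2 <= h ^+ 2 by rewrite ler_sqr ?nnegrE// ltW.
have u3 : u ^+ 3 <= h ^+ 2.
  by rewrite exprSr; apply: le_trans u2; rewrite ler_piMr ?sqr_ge0//; lra.
have u01 : 0 <= u <= 1 by lra.
have B1 : `|h ^+ 2 * (t / 2 * cos t)| <= h ^+ 2 * (T / 2 * 1).
  apply: ler_normM; first by rewrite ger0_norm.
  by apply: ler_normM; [rewrite ger0_norm; lra|exact: cos_max].
have B2 : `|sin t * (cos u - 1)| <= 1 * h ^+ 2.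
  by apply: ler_normM; [exact: sin_max|exact: le_trans (cos_taylor0 _ u01) u2].
have B3 : `|cos t * (sin u - u)| <= 1 * h ^+ 2.
  by apply: ler_normM; [exact: cos_max|exact: le_trans (sin_taylor1 _ u01) u3].
have -> : p - sin (t + u) - residual_lin h t u =
   (p - (pc_approx h t).1) - h ^+ 2 * (t / 2 * cos t)
   - sin t * (cos u - 1) - cos t * (sin u - u).
  by rewrite sinD /residual_lin /pc_approx /=; field.
apply: (le_trans (ler_normB _ _)).
have := ler_normB (p - (pc_approx h t).1 - h ^+ 2 * (t / 2 * cos t)) (sin t * (cos u - 1)).
have := ler_normB (p - (pc_approx h t).1) (h ^+ 2 * (t / 2 * cos t)).
lra.
Qed.

(** Antiderivative in s of (c - sin s)^2. With it the cell integrals become differences of values,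
    and the variance is expanded without any integral. *)
Definition residual_primitive c (s : R) : R :=
  c ^+ 2 * s + 2 * c * cos s + s / 2 - sin s * cos s / 2.

Lemma is_derive_residual_primitive c (s : R) :
  is_derive s 1 (residual_primitive c) ((c - sin s) ^+ 2).
Proof.
rewrite /residual_primitive; pointwise_derive.
have -> : (c - sin s) ^+ 2 =
    c ^+ 2 - 2 * c * sin s + sin s ^+ 2 / 2 + (1 - cos s ^+ 2) / 2.
  by rewrite -sin2cos2; field.
by field.
Qed.

(** The exact and the linearised integrands are squares of two quantities of order h that differ by
    O(h^2). The squares thus differ by O(h^3), and the mean value inequality on a cell of length h
    gives O(h^4). *)
Lemma residual_cell T : 0 < T -> exists2 C : R, 0 <= C & forall h n,
  0 < h <= 1 -> n%:R * h <= T ->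
  `|residual_primitive (pc_coef h n).1 (n.+1%:R * h)
    - residual_primitive (pc_coef h n).1 (n%:R * h)
    - h ^+ 3 * error_density (n%:R * h)| <= C * h ^+ 4.
Proof.
move=> T0; have [C C0 HC] := pc_coef_residual T T0.
exists (C * (C + 2 * (1 + T))); first by rewrite mulr_ge0//; lra.
move=> h n h01 nT; have /andP[h0 h1] := h01.
have t0 : 0 <= n%:R * h by rewrite mulr_ge0// ltW.
have -> : n.+1%:R * h = n%:R * h + h by rewrite -natr1; ring.
have {}HC u := HC h n u h01 nT.
set c := (pc_coef h n).1 in HC *; set t := n%:R * h in t0 nT HC *.
(* Antiderivative in u of the squared linear residual; its increment over [0, h] is exactly h^3
   [error_density] t. *)
pose Q u : R := - (h - u) ^+ 3 / 3 * cos t ^+ 2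
  + (h - u) ^+ 2 / 2 * (h * t * sin t * cos t) + (h * t / 2 * sin t) ^+ 2 * u.
pose f u := residual_primitive c (t + u) - Q u.
have dQ : forall u, is_derive u 1 Q (residual_lin h t u ^+ 2).
  by move=> u; rewrite /Q /residual_lin; pointwise_derive; field.
have df : forall u, is_derive u 1 f
    ((c - sin (t + u)) ^+ 2 - residual_lin h t u ^+ 2).
  move=> u; rewrite /f /Q /residual_lin /residual_primitive; pointwise_derive.
  have := sin2cos2 (t + u); set S := sin (t + u); set K := cos (t + u) => SK.
  have -> : (c - S) ^+ 2 = c ^+ 2 - 2 * c * S + S ^+ 2 / 2 + (1 - K ^+ 2) / 2.
    by rewrite -SK; field.
  by field.
have := derive_norm_le f _ 0 h (C * (C + 2 * (1 + T)) * h ^+ 3) (ltW h0) df.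
rewrite subr0 /f /Q !addr0.
have -> : forall x y z w : R, x - y - (z - w) = x - z - (y - w).
  by move=> *; ring.
have -> : C * (C + 2 * (1 + T)) * h ^+ 3 * h = C * (C + 2 * (1 + T)) * h ^+ 4 by ring.
move=> H; apply: le_trans (H _).
  rewrite le_eqVlt; apply/orP; left; apply/eqP; congr (`| _ - _ |).
  by rewrite /error_density; field.
move=> u uh; have := HC u uh; have /andP[u0 uh'] := uh.
set q := residual_lin h t u; move=> Hr.
have -> : (c - sin (t + u)) ^+ 2 - q ^+ 2 =
  (c - sin (t + u) - q) * ((c - sin (t + u) - q) + 2 * q) by ring.
have -> : C * (C + 2 * (1 + T)) * h ^+ 3 = C * h ^+ 2 * (C * h + 2 * (1 + T) * h).
  by ring.
apply: ler_normM => //; apply: (le_trans (ler_normD _ _)); apply: lerD.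
  apply: (le_trans Hr); rewrite ler_wpM2l// expr2 ler_piMr//; lra.
rewrite normrM ger0_norm// -mulrA ler_wpM2l// /q /residual_lin [X in _ <= X]mulrDl.
apply: (le_trans (ler_normB _ _)); apply: lerD.
  rewrite mul1r -[leRHS]mulr1; apply: ler_normM; last exact: cos_max.
  by rewrite ger0_norm; lra.
rewrite -[leRHS]mulr1; apply: ler_normM; last exact: sin_max.
have : h * t <= T * h by rewrite mulrC ler_wpM2r// ltW.
have : 0 <= h * t by rewrite mulr_ge0// ltW.
by move=> ? ?; rewrite ger0_norm; lra.
Qed.

Definition residual_variance h N : R :=
  \sum_(n < N) (residual_primitive (pc_coef h n).1 (n.+1%:R * h)
                - residual_primitive (pc_coef h n).1 (n%:R * h)).

Lemma residual_variance_expansion T : 0 < T -> exists2 C : R, 0 <= C & forall N,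
  (0 < N)%N -> T / N%:R <= 1 ->
  `|residual_variance (T / N%:R) N - error_constant T * (T / N%:R) ^+ 2|
  <= C * (T / N%:R) ^+ 3.
Proof.
move=> T0; have [C C0 HC] := residual_cell T T0.
set L := 2 + T + T ^+ 2; have L0 : 0 <= L by rewrite /L !addr_ge0// ?sqr_ge0 // ltW.
(* Each cell contributes C h^4 from [residual_cell] and L h^4 from moving the density within the
   cell; there are N cells and N h = T. *)
exists (T * (C + L)); first by rewrite mulr_ge0//; lra.
move=> N N0; set h := T / N%:R => h1.
have N0' : 0 < N%:R :> R by rewrite ltr0n.
have h0 : 0 < h by rewrite divr_gt0.
have NhT : N%:R * h = T by rewrite /h mulrC divfK// gt_eqF.
(* The constant is telescoped over the grid, so that the mean value theorem makes the comparison
   local to each cell. *)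
have -> : error_constant T * h ^+ 2 = \sum_(n < N)
    h ^+ 2 * (error_constant (n.+1%:R * h) - error_constant (n%:R * h)).
  rewrite -mulr_sumr -(big_mkord xpredT
     (fun n => error_constant (n.+1%:R * h) - error_constant (n%:R * h))).
  rewrite telescope_sumr// NhT mulr0n mul0r mulrC.
  have -> : error_constant (0 : R) = 0.
    by rewrite /error_constant !(mulr0, mul0r, sin0, addr0, subr0, expr0n).
  by rewrite subr0.
rewrite /residual_variance -sumrB; apply: (le_trans (ler_norm_sum _ _ _)).
have -> : T * (C + L) * h ^+ 3 = \sum_(n < N) ((C + L) * h ^+ 4).
  by rewrite sumr_const card_ord -mulr_natl -NhT; ring.
apply: ler_sum => /= n _.
have nN : n.+1%:R * h <= T.
  by rewrite -NhT ler_wpM2r ?(ltW h0)// ler_nat.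
have nN' : n%:R * h <= T by apply: le_trans nN; rewrite ler_wpM2r ?(ltW h0)// ler_nat.
have nh0 : 0 <= n%:R * h by rewrite mulr_ge0// ltW.
have h01 : 0 < h <= 1 by rewrite h0.
have B1 := HC h n h01 nN'.
have st : n%:R * h <= n.+1%:R * h by rewrite ler_wpM2r ?(ltW h0)// ler_nat.
have [x /andP[xl xr]] := derive_mean_value _ _ _ _ st is_derive_error_constant.
have -> : n.+1%:R * h - n%:R * h = h by rewrite -natr1; ring.
move=> kE; rewrite kE.
have B2 := error_density_lipschitz T (n%:R * h) x nh0 xl (le_trans xr nN).
have xh : x - n%:R * h <= h by move: xr; rewrite -natr1 mulrDl mul1r; lra.
have {}B2 : `|error_density x - error_density (n%:R * h)| <= L * h.
  by apply: (le_trans B2); rewrite ler_wpM2l.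
have B3 : `|h ^+ 3 * (error_density x - error_density (n%:R * h))| <= h ^+ 3 * (L * h).
  by apply: ler_normM => //; rewrite ger0_norm// exprn_ge0// ltW.
set G := residual_primitive _ _ - _ in B1 *.
have -> : G - h ^+ 2 * (error_density x * h) =
  (G - h ^+ 3 * error_density (n%:R * h))
  - h ^+ 3 * (error_density x - error_density (n%:R * h)) by ring.
apply: (le_trans (ler_normB _ _)).
have -> : (C + L) * h ^+ 4 = C * h ^+ 4 + h ^+ 3 * (L * h) by ring.
exact: lerD.
Qed.

(** Used with the cell and c fixed while the mesh tends to 0. The nodes run backwards from x because
    x - i delta is the time remaining to T when the time of W increases. *)
Lemma residual_riemann c x (delta : R) n : 0 <= delta ->
  `|\sum_(i < n) delta * (c - sin (x - i%:R * delta)) ^+ 2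
    - (residual_primitive c x - residual_primitive c (x - n%:R * delta))|
  <= n%:R * ((2 * `|c| + 2) * delta ^+ 2).
Proof.
move=> d0.
have -> : residual_primitive c x - residual_primitive c (x - n%:R * delta) =
  \sum_(i < n) (residual_primitive c (x - i%:R * delta)
               - residual_primitive c (x - i.+1%:R * delta)).
  rewrite -(big_mkord xpredT (fun i => residual_primitive c (x - i%:R * delta)
               - residual_primitive c (x - i.+1%:R * delta))).
  under eq_bigr do rewrite -opprB.
  by rewrite sumrN telescope_sumr// opprB mulr0n mul0r subr0.
rewrite -sumrB; apply: (le_trans (ler_norm_sum _ _ _)).
have -> : n%:R * ((2 * `|c| + 2) * delta ^+ 2) =
   \sum_(i < n) ((2 * `|c| + 2) * delta ^+ 2) by rewrite sumr_const card_ord mulr_natl.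
apply: ler_sum => /= i _.
set t := x - i%:R * delta.
have -> : x - i.+1%:R * delta = t - delta by rewrite /t -natr1; ring.
have st : t - delta <= t by lra.
have [y /andP[yl yr] ->] := derive_mean_value _ _ _ _ st (is_derive_residual_primitive c).
have -> : delta * (c - sin t) ^+ 2 - (c - sin y) ^+ 2 * (t - (t - delta)) =
  delta * ((sin y - sin t) * (2 * c - sin t - sin y)) by ring.
have B : `|sin t - sin y| <= 1 * (t - y).
  apply: (derive_norm_le sin cos) => // z _; exact: cos_max.
have -> : (2 * `|c| + 2) * delta ^+ 2 = delta * (delta * (2 * `|c| + 2)) by ring.
apply: ler_normM; first by rewrite ger0_norm.
apply: ler_normM; first by rewrite distrC; apply: (le_trans B); lra.
apply: (le_trans (ler_normB _ _)).
have := ler_normB (2 * c) (sin t); rewrite normrM (ger0_norm (_ : 0 <= 2))//.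
have := sin_max t; have := sin_max y; lra.
Qed.

End VarianceExpansion.

(** * Gaussian laws *)

Section GaussianDensity.
Context {R : realType}.
Local Notation mu := (@lebesgue_measure R).
Implicit Types (a b : R) (f : R -> \bar R).

Lemma measurable_affine a b : measurable_fun [set: R] (fun x : R => a * x + b).
Proof.
by apply: measurable_funD => //; exact: measurable_funM.
Qed.

Definition image_measure {d1 d2 : measure_display} {T1 : measurableType d1}
    {T2 : measurableType d2} (m : {measure set T1 -> \bar R}) {f : T1 -> T2}
    (mf : measurable_fun [set: T1] f) : {measure set T2 -> \bar R} :=
  ltac:(refine (pushforward m f : {measure set T2 -> \bar R}); exact: mf).

(** By uniqueness of Lebesgue measure it is enough to test half-open intervals; a positive slope
    pulls them back to half-open intervals of length divided by a. *)
Lemma lebesgue_measure_affine a b (A : set R) : 0 < a -> measurable A ->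
  mu A = (a%:E * mu ((fun x : R => (a * x + b)%R) @^-1` A))%E.
Proof.
move=> a0 mA.
pose m := mscale (NngNum (ltW a0))
  (image_measure (T2 := measurableTypeR R) mu (measurable_affine a b)).
rewrite -[RHS]/(m A); apply: lebesgue_measure_unique => // X [[x y]] xy <-.
rewrite -[RHS]/(a%:E * mu ((fun z : R => (a * z + b)%R) @^-1` `]x, y]))%E.
have -> : (fun x0 : R => a * x0 + b) @^-1` `]x, y]%classic =
   `](x - b) / a, (y - b) / a]%classic.
  apply/seteqP; split => z /=; rewrite !in_itv/= ltr_pdivrMr// ler_pdivlMr//;
    rewrite [a * z]mulrC => /andP[? ?]; apply/andP; split; lra.
rewrite !lebesgue_measure_itv/= !lte_fin ltr_pM2r ?invr_gt0// ltrD2r.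
case: ifPn => [_|]; last by rewrite mule0.
rewrite -!EFinD -EFinM; congr (_%:E).
by field; rewrite gt_eqF.
Qed.

(** The Radon-Nikodym derivative of the normal law and [normal_pdf] have the same integral over
    every measurable set, hence agree almost everywhere. *)
Lemma ge0_integral_normal_prob (m s : R) f : measurable_fun [set: R] f ->
  (forall x, 0 <= f x)%E ->
  (\int[normal_prob m s]_x f x = \int[mu]_x (f x * (normal_pdf m s x)%:E))%E.
Proof.
move=> mf f0.
have dom := normal_prob_dominates m s.
rewrite -(@Radon_Nikodym_SigmaFinite.change_of_variables _ _ _ (normal_prob m s) mu dom)//.
have mpdf : measurable_fun [set: R] (fun x => (normal_pdf m s x)%:E).
  by apply/measurable_EFinP; exact: measurable_normal_pdf.
have Ri := @Radon_Nikodym_SigmaFinite.f_integrable _ _ _ (normal_prob m s) mu dom.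
apply: ae_eq_integral => //.
- by apply: emeasurable_funM => //; exact: measurable_int Ri.
- exact: emeasurable_funM.
- apply: ae_eqe_mul2l; apply: integral_ae_eq => //.
  move=> A _ mA.
  by rewrite -Radon_Nikodym_SigmaFinite.f_integral.
Qed.



Lemma ge0_integral_affine a b f : 0 < a -> measurable_fun [set: R] f ->
  (forall x, 0 <= f x)%E ->
  (\int[mu]_x f x = \int[mu]_x (a%:E * f (a * x + b)%R))%E.
Proof.
move=> a0 mf f0.
pose mA := measurable_affine a b.
rewrite ge0_integralZl//; first last.
- by rewrite lee_fin ltW.
- exact: measurableT_comp.
transitivity (\int[mscale (NngNum (ltW a0))
    (image_measure (T2 := measurableTypeR R) mu mA)]_x f x)%E.
  apply: eq_measure_integral => A mA' _; exact: lebesgue_measure_affine.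
rewrite ge0_integral_mscale//; congr (_ * _)%E.
exact: (@ge0_integral_pushforward _ _ (measurableTypeR R) (measurableTypeR R) R _
  mA mu setT f measurableT mf (fun x _ => f0 x)).
Qed.

Lemma ge0_integral_opp f : measurable_fun [set: R] f -> (forall x, 0 <= f x)%E ->
  (\int[mu]_x f x = \int[mu]_x f (- x)%R)%E.
Proof.
move=> mf f0.
have mN : measurable_fun [set: R] (-%R : R -> measurableTypeR R) by exact: oppr_measurable.
transitivity (\int[image_measure mu mN]_x f x)%E.
  by apply: eq_measure_integral => A mA _; exact/esym/lebesgue_measureN.
exact: (@ge0_integral_pushforward _ _ (measurableTypeR R) (measurableTypeR R) R _
  mN mu setT f measurableT mf (fun x _ => f0 x)).
Qed.

End GaussianDensity.

Section StandardGaussian.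
Context {R : realType}.
Local Notation mu := (@lebesgue_measure R).
Local Notation gauss := (@normal_prob R 0 1).
Local Notation phi := (@normal_pdf R 0 1).
Implicit Types (s t : R) (B : set R).

Lemma standard_normal_pdfE (x : R) : phi x = normal_peak 1 * expR (- x ^+ 2 / 2).
Proof.
by rewrite normal_pdfE ?oner_neq0// /normal_fun subr0 expr1n.
Qed.

Lemma preimage_scale_measurable s B : measurable B ->
  measurable ((fun x : R => s * x) @^-1` B).
Proof.
move=> mB; rewrite -[X in measurable X]setTI.
by apply: (measurable_funM (measurable_cst s) (@measurable_id _ _ setT)).
Qed.

Lemma integral_indic_preimage d (T : measurableType d) (m : {measure set T -> \bar R})
    (g : T -> R) B : measurable_fun [set: T] g -> measurable B ->
  (\int[m]_x (\1_B (g x))%:E = m (g @^-1` B))%E.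
Proof.
move=> mg mB.
have mgB : measurable (g @^-1` B) by rewrite -[X in measurable X]setTI; exact: mg.
by rewrite -[g @^-1` B in RHS]setIT -integral_indic.
Qed.

(** The bridge from the normal laws of the statement to images of the standard normal law. *)
Lemma normal_prob_scale s B : 0 < s -> measurable B ->
  normal_prob 0 s B = gauss ((fun x : R => s * x) @^-1` B).
Proof.
move=> s0 mB.
have mI : measurable_fun [set: R] (fun x => (\1_B x)%:E : \bar R).
  exact/measurable_EFinP/measurable_indic.
have mS : measurable_fun [set: R] (fun x : R => s * x).
  by exact: measurable_funM.
transitivity (\int[normal_prob 0 s]_x (\1_B x)%:E)%E.
  by rewrite integral_indic// setIT.
transitivity (\int[gauss]_x (\1_B (s * x))%:E)%E; last first.
  exact: (integral_indic_preimage _ _ gauss _ _ mS mB).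
have I0 x : (0%R <= (\1_B x : R)%:E)%E by rewrite lee_fin.
have mIS : measurable_fun [set: R] (fun x => (\1_B (s * x))%:E : \bar R).
  by apply/measurable_EFinP; apply: measurableT_comp => //; exact: measurable_indic.
rewrite (ge0_integral_normal_prob 0 s _ mI I0).
rewrite (ge0_integral_normal_prob 0 1 _ mIS (fun x => I0 _)).
rewrite (ge0_integral_affine s 0)//; first last.
- by move=> x; rewrite mule_ge0// ?lee_fin ?normal_pdf_ge0.
- by apply: emeasurable_funM => //; apply/measurable_EFinP; exact: measurable_normal_pdf.
apply: eq_integral => x _; rewrite addr0 -!EFinM; congr (_%:E).
rewrite mulrCA; congr (_ * _).
rewrite standard_normal_pdfE normal_pdfE ?gt_eqF// /normal_fun /normal_peak.
rewrite subr0 expr1n mul1r exprMn.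
have -> : - (s ^+ 2 * x ^+ 2) / (s ^+ 2 *+ 2) = - x ^+ 2 / 2 by field; rewrite gt_eqF.
rewrite mulrA; congr (_ * _).
rewrite -mulrnAr sqrtrM ?sqr_ge0// sqrtr_sqr ger0_norm ?ltW// invfM mulrA divff ?mul1r//.
by rewrite gt_eqF.
Qed.

Lemma standard_normal_pdf_rotate s t (z w r : R) : r != 0 -> r ^+ 2 = s ^+ 2 + t ^+ 2 ->
  phi ((s * z - t * w) / r) * phi ((s * w + t * z) / r) = phi z * phi w.
Proof.
move=> r0 rE; rewrite !standard_normal_pdfE.
rewrite mulrACA -expRD [RHS]mulrACA -expRD; congr (_ * expR _).
rewrite !expr_div_n rE.
have st0 : s ^+ 2 + t ^+ 2 != 0 by rewrite -rE expf_neq0.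
by field.
Qed.

(* The rotation taking (s, t) to the first axis is written as two shears, each of
   which is a one-dimensional affine substitution. *)
Lemma gauss_convolution s t B : 0 < s -> measurable B ->
  (gauss \x gauss)%E [set z : R * R | B (s * z.1 + t * z.2)] =
  gauss ((fun x : R => Num.sqrt (s ^+ 2 + t ^+ 2) * x) @^-1` B).
Proof.
move=> s0 mB; set r := Num.sqrt _.
have st0 : 0 < s ^+ 2 + t ^+ 2 by rewrite ltr_pwDl ?sqr_ge0// exprn_gt0.
have r0 : 0 < r by rewrite sqrtr_gt0.
have rE : r ^+ 2 = s ^+ 2 + t ^+ 2 by rewrite sqr_sqrtr// ltW.
have rn0 : r != 0 by rewrite gt_eqF.
have sn0 : s != 0 by rewrite gt_eqF.
have mphi : measurable_fun [set: R] phi by exact: measurable_normal_pdf.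
have mI : measurable_fun [set: R] (\1_B : R -> R) by exact: measurable_indic.
have phi0 x : 0 <= phi x by exact: normal_pdf_ge0.
have m2 (a b : R) : measurable_fun [set: R * R] (fun z : R * R => a * z.1 + b * z.2).
  by apply: measurable_funD; apply: measurable_funM.
have m1 (a b : R) : measurable_fun [set: R] (fun z : R => a * z + b).
  exact: measurable_affine.
rewrite -(integral_indic_preimage _ _ (gauss \x gauss)%E _ _ (m2 s t) mB).
pose f (x y : R) : \bar R := (\1_B (s * x + t * y))%:E.
have mf : measurable_fun [set: R * R] (fun z : R * R => f z.1 z.2).
  by apply/measurable_EFinP; exact: (measurableT_comp mI (m2 s t)).
have f0 z : (0%R <= f z.1 z.2)%E by rewrite lee_fin.
have mI2 (a b : R) : measurable_fun [set: R] (fun x : R => \1_B (a * x + b) : R).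
  exact: (measurableT_comp mI (m1 a b)).
transitivity (\int[gauss]_x \int[gauss]_y f x y)%E.
  exact: (fubini_tonelli1 (m1 := gauss) (m2 := gauss) (fun z : R * R => f z.1 z.2) mf f0).
transitivity (\int[gauss]_y \int[gauss]_x f x y)%E.
  exact: (fubini_tonelli (m1 := gauss) (m2 := gauss) (fun z : R * R => f z.1 z.2) mf f0).
have mG : measurable_fun [set: R] (fun y => \int[gauss]_x f x y)%E.
  exact: (measurable_fun_fubini_tonelli_G (m1 := gauss) (fun z : R * R => f z.1 z.2) mf f0).
rewrite (ge0_integral_normal_prob 0 1 _ mG); last first.
  by move=> y; apply: integral_ge0 => x _; rewrite lee_fin.
(* Integrand after the first shear x = (r / s) z - (t / s) y, chosen so that s x + t y = r z. *)
pose k (z y : R) : \bar R :=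
  (r / s * (\1_B (r * z) * phi (r / s * z + - (t / s) * y)) * phi y)%:E.
have mk : measurable_fun [set: R * R] (fun z : R * R => k z.1 z.2).
  apply/measurable_EFinP; apply: measurable_funM; last exact: measurableT_comp.
  apply: measurable_funM => //; apply: measurable_funM.
    apply: measurableT_comp => //; apply: measurable_funM => //.
  exact: (measurableT_comp mphi (m2 _ _)).
have k0 z : (0%R <= k z.1 z.2)%E.
  rewrite lee_fin; apply: mulr_ge0 => //; apply: mulr_ge0.
    by rewrite divr_ge0// ltW.
  exact: mulr_ge0.
transitivity (\int[mu]_y \int[mu]_z k z y)%E.
  apply: eq_integral => y _.
  have mfy : measurable_fun [set: R] (f ^~ y) by apply/measurable_EFinP; exact: (mI2 s (t * y)).
  rewrite (ge0_integral_normal_prob 0 1 (f ^~ y) mfy (fun x => f0 (x, y))).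
  rewrite (ge0_integral_affine (r / s) (- (t / s) * y)); first last.
  - by move=> x; apply: mule_ge0; [exact: (f0 (x, y))|rewrite lee_fin].
  - by apply: emeasurable_funM; apply/measurable_EFinP; [exact: mI2|].
  - by rewrite divr_gt0.
  rewrite -ge0_integralZr//; first last.
  - by rewrite lee_fin.
  - move=> x _; apply: mule_ge0; first by rewrite lee_fin divr_ge0// ltW.
    by apply: mule_ge0; [exact: (f0 (_, y))|rewrite lee_fin].
  - apply: emeasurable_funM => //; apply: emeasurable_funM; apply/measurable_EFinP.
      exact: (measurableT_comp (mI2 _ _) (m1 _ _)).
    exact: (measurableT_comp mphi (m1 _ _)).
  apply: eq_integral => x _; rewrite /f /k -!EFinM; congr (_ * (\1_B _ * _) * _)%:E.
  by field.
rewrite -(fubini_tonelli (m1 := mu) (m2 := mu) (fun z : R * R => k z.1 z.2) mk k0).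
transitivity (\int[gauss]_z (\1_B (r * z))%:E)%E; last first.
  apply: (integral_indic_preimage _ _ gauss _ _ _ mB).
  exact: (measurable_funM (measurable_cst r) (@measurable_id _ _ setT)).
have mIr : measurable_fun [set: R] (fun z => (\1_B (r * z))%:E : \bar R).
  apply/measurable_EFinP; apply: (measurableT_comp mI).
  exact: (measurable_funM (measurable_cst r) (@measurable_id _ _ setT)).
have Ir0 z : (0%R <= (\1_B (r * z) : R)%:E)%E by rewrite lee_fin.
rewrite (ge0_integral_normal_prob 0 1 _ mIr Ir0).
apply: eq_integral => z _ /=.
(* The second shear completes the rotation: the Jacobians r / s and s / r cancel, and rotation
   invariance separates the densities in z and y. *)
rewrite (ge0_integral_affine (s / r) (t / r * z)); first last.
- by move=> y; exact: (k0 (z, y)).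
- exact: (measurableT_comp mk (measurable_pair1 z)).
- by rewrite divr_gt0.
transitivity (\int[mu]_y (((\1_B (r * z) * phi z)%:E) * (phi y)%:E))%E.
  apply: eq_integral => y _; rewrite /k -!EFinM; congr (_%:E).
  have -> : r / s * z + - (t / s) * (s / r * y + t / r * z) = (s * z - t * y) / r.
    have -> : r / s * z = r ^+ 2 / s / r * z by field; rewrite rn0 sn0.
    by rewrite rE; field; rewrite rn0 sn0.
  have -> : s / r * y + t / r * z = (s * y + t * z) / r by field.
  rewrite -[RHS]mulrA -(standard_normal_pdf_rotate s t z y r rn0 rE).
  by field; rewrite rn0 sn0.
rewrite ge0_integralZl//; first last.
- by rewrite lee_fin mulr_ge0.
- by move=> x _; rewrite lee_fin.
- exact/measurable_EFinP.
by rewrite integral_normal_pdf mule1.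
Qed.

End StandardGaussian.

(** * Sums of independent Gaussian variables *)

Section GaussianSums.
Context {d : measure_display} {Omega : measurableType d} {R : realType}.
Variable P : probability Omega R.
Local Notation gauss := (@normal_prob R 0 1).
Local Notation rT2 := (measurableTypeR R * measurableTypeR R)%type.
Implicit Types (s t c : R) (B : set R) (U V : Omega -> R) (E : set Omega).

(* The law of s times a standard normal variable: it is degenerate, as it should
   be, at s = 0. *)
Definition gaussian_law s B : \bar R := gauss ((fun x : R => s * x) @^-1` B).

Definition is_gaussian U s := measurable_fun [set: Omega] U /\
  forall B, measurable B -> P (U @^-1` B) = gaussian_law s B.

Lemma measurable_scale s : measurable_fun [set: R] (fun x : R => s * x).
Proof. exact: (measurable_funM (measurable_cst s) (@measurable_id _ _ setT)). Qed.

Lemma gaussian_law_opp s B : measurable B -> gaussian_law (- s) B = gaussian_law s B.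
Proof.
move=> mB; rewrite /gaussian_law.
have mI (a : R) : measurable_fun [set: R] (fun x => (\1_B (a * x))%:E : \bar R).
  apply/measurable_EFinP; apply: (measurableT_comp (measurable_indic mB)).
  exact: measurable_scale.
have I0 (a : R) x : (0%R <= (\1_B (a * x) : R)%:E)%E by rewrite lee_fin.
rewrite -(integral_indic_preimage _ _ gauss _ _ (measurable_scale (- s)) mB).
rewrite -[RHS](integral_indic_preimage _ _ gauss _ _ (measurable_scale s) mB).
rewrite (ge0_integral_normal_prob 0 1 _ (mI (- s)) (I0 (- s))).
rewrite (ge0_integral_normal_prob 0 1 _ (mI s) (I0 s)).
rewrite ge0_integral_opp; first last.
- by move=> x; rewrite mule_ge0// lee_fin normal_pdf_ge0.
- by apply: emeasurable_funM => //; apply/measurable_EFinP; exact: measurable_normal_pdf.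
apply: eq_integral => x _; rewrite mulrNN; congr (_ * _%:E)%E.
by rewrite !standard_normal_pdfE sqrrN.
Qed.

Lemma gaussian_law_norm s B : measurable B -> gaussian_law `|s| B = gaussian_law s B.
Proof.
by move=> mB; case: (leP 0 s) => s0; [rewrite ger0_norm|rewrite ltr0_norm// gaussian_law_opp].
Qed.

(** The case s = 0 is where the induction over partial sums starts. The resulting scale is then the
    absolute value of t, and the symmetry of the Gaussian law removes it. *)
Lemma gaussian_law_conv s t B : 0 <= s -> measurable B ->
  (gauss \x gauss)%E [set z : R * R | B (s * z.1 + t * z.2)] =
  gaussian_law (Num.sqrt (s ^+ 2 + t ^+ 2)) B.
Proof.
rewrite le_eqVlt => /predU1P[<- mB|]; last exact: gauss_convolution.
rewrite expr0n add0r sqrtr_sqr gaussian_law_norm//.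
have -> : [set z : R * R | B (0 * z.1 + t * z.2)] =
    setT `*` ((fun x : R => t * x) @^-1` B).
  by apply/seteqP; split => -[x y] /=; rewrite mul0r add0r; [split|case].
rewrite product_measure1E//; last exact: preimage_scale_measurable.
by rewrite [X in (X * _)%E](probability_setT gauss) mul1e.
Qed.

(** The event E stands for conditions on the increments not yet summed, so that independence from
    them survives each addition. The product rule on rectangles extends to C by uniqueness of the
    product measure, applied to P restricted to E and divided by P E. *)
Lemma gaussian_pair U V E s t (C : set (R * R)) :
  is_gaussian U s -> is_gaussian V t -> measurable E ->
  (forall A B, measurable A -> measurable B ->
    P (U @^-1` A `&` V @^-1` B `&` E) =
    (gaussian_law s A * gaussian_law t B * P E)%E) ->
  measurable C ->
  P ((fun w => (U w, V w)) @^-1` C `&` E) =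
  ((gauss \x gauss)%E [set z : R * R | C (s * z.1, t * z.2)%R] * P E)%E.
Proof.
move=> [mU _] [mV _] mE prodE mC.
have mUV : measurable_fun [set: Omega] (fun w => (U w, V w)).
  exact: measurable_fun_pair.
have mCUV : measurable ((fun w => (U w, V w)) @^-1` C).
  by rewrite -[X in measurable X]setTI; exact: mUV.
pose sc (a : R) : {mfun (measurableTypeR R) >-> (measurableTypeR R)} :=
  HB.pack (fun x : R => a * x)
    (isMeasurableFun.Build _ _ (measurableTypeR R) (measurableTypeR R) _ (measurable_scale a)).
pose m1 := distribution gauss (sc s).
pose m2 := distribution gauss (sc t).
have mst : measurable_fun [set: R * R] (fun z : R * R => (s * z.1, t * z.2)).
  by apply: measurable_fun_pair; exact: measurable_funM.
have C2 : (gauss \x gauss)%E [set z : R * R | C (s * z.1, t * z.2)%R] = (m1 \x m2)%E C.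
  rewrite (@product_measure_unique _ _ (measurableTypeR R) (measurableTypeR R) R m1 m2
    (image_measure (T1 := rT2) (T2 := rT2) (gauss \x gauss)%E mst))//.
  move=> A B mA mB.
  have -> : image_measure (T1 := rT2) (T2 := rT2) (gauss \x gauss)%E mst (A `*` B) =
     (gauss \x gauss)%E (((fun x : R => s * x) @^-1` A) `*` ((fun x : R => t * x) @^-1` B)).
    by [].
  by rewrite product_measure1E//; exact: preimage_scale_measurable.
rewrite C2.
(* A null event cannot be normalised; both sides then vanish. *)
have [PE0|PE0] := eqVneq (P E) 0%E.
  rewrite PE0 mule0; apply/eqP; rewrite eq_le measure_ge0 andbT -PE0.
  by apply: le_measure; rewrite ?inE//; exact: measurableI.
have PEr : P E = (fine (P E))%:E by rewrite fineK// fin_num_measure.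
have r0 : 0 < fine (P E).
  by rewrite fine_gt0// lt0e PE0 measure_ge0/= -ge0_fin_numE// fin_num_measure.
have r0' : 0 <= (fine (P E))^-1 by rewrite invr_ge0 ltW.
rewrite (@product_measure_unique _ _ (measurableTypeR R) (measurableTypeR R) R m1 m2
  (mscale (NngNum r0') (image_measure (T2 := rT2) (mrestr P mE) mUV)))//.
  rewrite -[X in (X * _)%E]/(((fine (P E))^-1)%:E * P ((fun w => (U w, V w)) @^-1` C `&` E))%E.
  rewrite [in RHS]PEr muleAC -EFinM mulVf ?gt_eqF// mul1e //.
move=> A B mA mB.
rewrite -[LHS]/(((fine (P E))^-1)%:E * P (U @^-1` A `&` V @^-1` B `&` E))%E.
rewrite prodE// [in LHS]PEr muleCA -EFinM mulVf ?gt_eqF// mule1//.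
Qed.

Lemma gaussian_add U V E s t c B :
  is_gaussian U s -> is_gaussian V t -> measurable E -> 0 <= s ->
  (forall A B, measurable A -> measurable B ->
    P (U @^-1` A `&` V @^-1` B `&` E) =
    (gaussian_law s A * gaussian_law t B * P E)%E) ->
  measurable B ->
  P ((fun w => U w + c * V w) @^-1` B `&` E) =
  (gaussian_law (Num.sqrt (s ^+ 2 + (c * t) ^+ 2)) B * P E)%E.
Proof.
move=> gU gV mE s0 prodE mB.
have mc : measurable_fun [set: R * R] (fun z : R * R => z.1 + c * z.2).
  by apply: measurable_funD => //; exact: measurable_funM.
rewrite -gaussian_law_conv//.
have mC : measurable ((fun z : R * R => z.1 + c * z.2) @^-1` B).
  by rewrite -[X in measurable X]setTI; exact: mc.
apply: (etrans (gaussian_pair U V E s t _ gU gV mE prodE mC)).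
congr (_ * _)%E; congr ((gauss \x gauss)%E _).
by apply/seteqP; split => z /=; rewrite mulrA.
Qed.

Lemma gaussian_cst0 : is_gaussian (fun=> 0) 0.
Proof.
split=> // B mB; rewrite /gaussian_law.
have [B0|B0] := pselect (B 0).
  have -> : (fun=> 0) @^-1` B = [set: Omega] by apply/seteqP; split.
  have -> : (fun x : R => 0 * x) @^-1` B = setT.
    by apply/seteqP; split => x //=; rewrite mul0r.
  by rewrite !probability_setT.
have -> : (fun=> 0) @^-1` B = set0 :> set Omega by apply/seteqP; split.
have -> : (fun x : R => 0 * x) @^-1` B = set0.
  by apply/seteqP; split => x //=; rewrite mul0r.
by rewrite !measure0.
Qed.

End GaussianSums.

Section IndependentGaussianSum.
Context {d : measure_display} {Omega : measurableType d} {R : realType}.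
Variable P : probability Omega R.
Variables (n : nat) (D : nat -> Omega -> R) (s g : nat -> R).
Hypothesis D_gaussian : forall i, (i < n)%N -> is_gaussian P (D i) (s i).
Hypothesis D_independent : mutually_independent P (fun i : 'I_n => D i).

Let S k (w : Omega) := \sum_(i < k) g i * D i w.
Let sd k := Num.sqrt (\sum_(i < k) (g i * s i) ^+ 2).
Let E k (C : nat -> set R) : set Omega := [set w | forall i, (k <= i < n)%N -> C i (D i w)].

Let mD i : (i < n)%N -> measurable_fun [set: Omega] (D i).
Proof. by move=> /D_gaussian []. Qed.

Let mE k C : (forall i, measurable (C i)) -> measurable (E k C).
Proof.
move=> mC; have -> : E k C = \bigcap_(i in [set i | (k <= i < n)%N]) (D i @^-1` C i).
  by apply/seteqP; split.
apply: bigcap_measurableType => i /andP[_ lin].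
by rewrite -[X in measurable X]setTI; exact: mD.
Qed.

Let mS k : (k <= n)%N -> measurable_fun [set: Omega] (S k).
Proof.
move=> kn; apply: measurable_sum => i; apply: measurable_funM => //.
by apply: mD; exact: leq_trans kn.
Qed.

(** The induction needs more than the law of the partial sum: it must also keep that sum independent
    of all later variables, hence the factor for arbitrary sets C i with k <= i. *)
Let joint_law k : (k <= n)%N -> forall B (C : nat -> set R),
  measurable B -> (forall i, measurable (C i)) ->
  P (S k @^-1` B `&` E k C) =
  (gaussian_law (sd k) B * \prod_(k <= i < n) P (D i @^-1` C i))%E.
Proof.
elim: k => [_|k IH kn] B C mB mC.
  have ES : S 0%N = (fun=> 0) by apply/funext => w; rewrite /S big_ord0.
  have Esd : sd 0%N = 0 by rewrite /sd big_ord0 sqrtr0.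
  rewrite ES Esd; have [_ /(_ B mB)] := gaussian_cst0 P; rewrite /gaussian_law => <-.
  have EP : P (E 0%N C) = (\prod_(0 <= i < n) P (D i @^-1` C i))%E.
    rewrite big_mkord -(D_independent (fun i : 'I_n => C i)); last by move=> i; exact: mC.
    congr (P _); apply/seteqP; split => w /= Ew i; last first.
      by move=> lin; exact: (Ew (Ordinal lin)).
    by move=> _; apply: Ew; rewrite ltn_ord.
  have [B0|B0] := pselect (B 0).
    have -> : (fun=> 0) @^-1` B = [set: Omega] by apply/seteqP; split.
    by rewrite setTI probability_setT mul1e.
  have -> : (fun=> 0) @^-1` B = set0 :> set Omega by apply/seteqP; split.
  by rewrite set0I measure0 mul0e.
have {}IH := IH (ltnW kn).
have P1 j : (\prod_(j <= i < n) P (D i @^-1` setT) = 1)%E.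
  by rewrite big1// => i _; rewrite preimage_setT probability_setT.
have gS : is_gaussian P (S k) (sd k).
  split; first exact: mS (ltnW kn).
  move=> A mA; have := IH A (fun=> setT) mA (fun=> measurableT).
  by rewrite P1 mule1 => <-; congr (P _); apply/seteqP; split => w //= -[].
have gD := D_gaussian k kn.
(* Placing A in slot k lets the induction hypothesis describe the partial sum, the next variable and
   the later ones jointly. *)
pose upd (A : set R) i := if i == k then A else C i.
have mupd A : measurable A -> forall i, measurable (upd A i).
  by move=> mA i; rewrite /upd; case: ifP.
have prod_upd A : (\prod_(k <= i < n) P (D i @^-1` upd A i) =
    P (D k @^-1` A) * \prod_(k.+1 <= i < n) P (D i @^-1` C i))%E.
  rewrite big_ltn// /upd eqxx; congr (_ * _)%E.
  rewrite big_nat_cond [RHS]big_nat_cond; apply: eq_bigr => i.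
  by rewrite andbT => /andP[ki _]; rewrite gtn_eqF.
have E_upd A : E k (upd A) = D k @^-1` A `&` E k.+1 C.
  apply/seteqP; split => w /=.
    move=> Ew; split; first by have := Ew k; rewrite /upd eqxx leqnn kn; apply.
    move=> i /andP[ki lin]; have := Ew i; rewrite /upd gtn_eqF// (ltnW ki) lin.
    exact.
  move=> [Aw Ew] i /andP[ki lin]; rewrite /upd; case: eqVneq => [->//|nik].
  by apply: Ew; rewrite lin andbT ltn_neqAle eq_sym nik.
have PE : P (E k.+1 C) = (\prod_(k.+1 <= i < n) P (D i @^-1` C i))%E.
  have := IH setT (upd setT) measurableT (mupd _ measurableT).
  rewrite prod_upd E_upd !preimage_setT !setTI /gaussian_law preimage_setT.
  by rewrite !probability_setT !mul1e.
have prodE A B' : measurable A -> measurable B' ->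
    P (S k @^-1` A `&` D k @^-1` B' `&` E k.+1 C) =
    (gaussian_law (sd k) A * gaussian_law (s k) B' * P (E k.+1 C))%E.
  move=> mA mB'; rewrite -setIA -E_upd IH//; last exact: mupd.
  by rewrite prod_upd PE muleA gD.2.
have := gaussian_add P (S k) (D k) (E k.+1 C) (sd k) (s k) (g k) B gS gD
  (mE k.+1 C mC) (sqrtr_ge0 _) prodE mB.
rewrite PE sqr_sqrtr; last by apply: sumr_ge0 => i _; exact: sqr_ge0.
rewrite /sd big_ord_recr /= => <-.
have -> // : S k.+1 = fun w => S k w + g k * D k w.
by apply/funext => w; rewrite /S big_ord_recr.
Qed.

Lemma gaussian_sum : is_gaussian P (fun w => \sum_(i < n) g i * D i w)
  (Num.sqrt (\sum_(i < n) (g i * s i) ^+ 2)).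
Proof.
split; first exact: (mS n (leqnn n)).
move=> B mB; have := joint_law n (leqnn n) B (fun=> setT) mB (fun=> measurableT).
rewrite big_geq// mule1 => <-; congr (P _).
by apply/seteqP; split => w //= -[].
Qed.

End IndependentGaussianSum.

Section BrownianSum.
Context {d : measure_display} {Omega : measurableType d} {R : realType}.
Context {P : probability Omega R}.

(** Strictly increasing times give every increment a positive variance, as [brownian_increment_law]
    requires. *)
Lemma brownian_sum_gaussian (W : R -> {RV P >-> R}) (n : nat) (t g : nat -> R) :
  is_brownian_motion W -> 0 <= t 0%N -> (forall i, t i < t i.+1) ->
  is_gaussian P (fun w => \sum_(i < n) g i * (W (t i.+1) w - W (t i) w))
    (Num.sqrt (\sum_(i < n) g i ^+ 2 * (t i.+1 - t i))).
Proof.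
move=> BW t0 tS.
have t_ge0 i : 0 <= t i by elim: i => // i IH; exact: le_trans IH (ltW (tS i)).
have -> : \sum_(i < n) g i ^+ 2 * (t i.+1 - t i) =
    \sum_(i < n) (g i * Num.sqrt (t i.+1 - t i)) ^+ 2.
  by apply: eq_bigr => i _; rewrite exprMn sqr_sqrtr// subr_ge0 ltW.
apply: (gaussian_sum P n (fun i w => W (t i.+1) w - W (t i) w)
  (fun i => Num.sqrt (t i.+1 - t i))).
  move=> i _; split; first exact: measurable_funB.
  move=> B mB; rewrite (brownian_increment_law BW)// normal_prob_scale//.
  by rewrite sqrtr_gt0 subr_gt0.
by apply: (brownian_independent_increments BW) => // i; exact: ltW.
Qed.

End BrownianSum.

(** * Second moment of the standard normal law *)

Section GaussianSecondMoment.
Context {R : realType}.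
Local Notation mu := (@lebesgue_measure R).
Local Notation gauss := (@normal_prob R 0 1).
Local Notation phi := (@normal_pdf R 0 1).

Lemma is_derive_standard_normal_pdf (x : R) : is_derive x 1 phi (- x * phi x).
Proof.
have -> : phi = (fun x => normal_peak 1 * expR (- x ^+ 2 / 2)).
  by apply/funext => y; exact: standard_normal_pdfE.
by pointwise_derive; field.
Qed.

Lemma continuous_sqr_pdf : continuous (fun x : R => x ^+ 2 * phi x).
Proof.
move=> x; apply: cvgM; first exact: sqr_continuous.
exact: continuous_normal_pdf.
Qed.

(** Integration by parts: x phi(x) has derivative phi(x) - x^2 phi(x), and it is odd, so the two
    ends contribute 2 a phi(a). *)
Lemma integral_sqr_pdf_segment (a : R) : 0 < a ->
  (\int[mu]_(x in `[(- a)%R, a]) (x ^+ 2 * phi x)%R%:E + (2 * (a * phi a))%R%:E =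
   \int[mu]_(x in `[(- a)%R, a]) (phi x)%:E)%E.
Proof.
move=> a0; have aa : - a < a by lra.
pose F (x : R) : R := x * phi x.
have dF : forall x : R, is_derive x 1 F (phi x - x ^+ 2 * phi x).
  move=> x; notypeclasses refine (is_derive_eq _ _).
    exact: (is_derive_ptM id phi x _ _ (is_derive_pt_id x) (is_derive_standard_normal_pdf x)).
  by rewrite /=; ring.
have cF : continuous F.
  by move=> x; apply/differentiable_continuous/derivable1_diffP; have [] := dF x.
have cphi : continuous phi by exact: continuous_normal_pdf.
have cd : continuous (fun x => phi x - x ^+ 2 * phi x).
  by move=> x; apply: cvgB; [exact: cphi|exact: continuous_sqr_pdf].
have FTC : (\int[mu]_(x in `[(- a)%R, a]) (phi x - x ^+ 2 * phi x)%:E = (F a)%:E - (F (- a))%:E)%E.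
  apply: continuous_FTC2 => //.
  - exact: continuous_subspaceT.
  - split; first by move=> x _; have [] := dF x.
      by apply: cvg_at_right_filter; exact: cF.
    by apply: cvg_at_left_filter; exact: cF.
  - by move=> x _; rewrite derive1E; have [_ ->] := dF x.
have i1 : mu.-integrable `[- a, a] (EFin \o phi).
  by apply: continuous_compact_integrable; [exact: segment_compact|exact: continuous_subspaceT].
have i2 : mu.-integrable `[- a, a] (EFin \o (fun x => x ^+ 2 * phi x)).
  apply: continuous_compact_integrable; first exact: segment_compact.
  by apply: continuous_subspaceT; exact: continuous_sqr_pdf.
have -> : (2 * (a * phi a))%R%:E = ((F a)%:E - (F (- a))%:E)%E.
  rewrite -EFinB /F; congr (_%:E).
  have -> : phi (- a) = phi a by rewrite !standard_normal_pdfE sqrrN.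
  by ring.
rewrite -FTC; under [X in (_ + X)%E]eq_integral do rewrite EFinB.
rewrite integralB//= addeC subeK//.
by apply: integrable_fin_num => //; exact: measurable_itv.
Qed.

Lemma gauss_second_moment : (\int[gauss]_x (x ^+ 2)%:E = 1)%E.
Proof.
have mphi : measurable_fun [set: R] phi by exact: measurable_normal_pdf.
have msq : measurable_fun [set: R] (fun x : R => x ^+ 2).
  exact: measurable_funX.
rewrite ge0_integral_normal_prob//; last 2 first.
- exact/measurable_EFinP.
- by move=> x; rewrite lee_fin sqr_ge0.
pose I n : set R := `[- n.+1%:R, n.+1%:R]%classic.
have IU : \bigcup_n I n = setT.
  apply/seteqP; split => // x _; exists (Num.truncn `|x|) => //.
  have := truncnS_gt `|x|; rewrite /I /= in_itv /= -ler_norml; exact: ltW.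
have ndI : nondecreasing_seq I.
  move=> m n mn; apply/subsetPset => x; rewrite /I /= !in_itv/= -!ler_norml => /le_trans; apply.
  by rewrite ler_nat ltnS.
have c1 : (\int[mu]_(x in I n) (x ^+ 2 * phi x)%R%:E)%E @[n --> \oo] -->
    (\int[mu]_x ((x ^+ 2)%:E * (phi x)%:E))%E.
  rewrite -IU; apply: ge0_nondecreasing_set_cvg_integral => //.
  - by move=> i; exact: measurable_itv.
  - by move=> i; apply/measurable_EFinP/measurable_funTS; exact: measurable_funM.
  - by move=> i x _; rewrite lee_fin mulr_ge0// ?sqr_ge0// normal_pdf_ge0.
have c2 : (\int[mu]_(x in I n) (phi x)%:E)%E @[n --> \oo] --> 1%E.
  rewrite -(integral_normal_pdf (0 : R) 1) -IU.
  apply: ge0_nondecreasing_set_cvg_integral => //.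
  - by move=> i; exact: measurable_itv.
  - by move=> i; apply/measurable_EFinP/measurable_funTS.
  - by move=> i x _; rewrite lee_fin normal_pdf_ge0.
have c3 : (2 * (n.+1%:R * phi n.+1%:R)) @[n --> \oo] --> (0 : R).
  apply: (@squeeze_cvgr _ _ _ _ (cst 0) (fun n => 4 * normal_peak 1 * harmonic n)).
  - near=> n; apply/andP; split; first by rewrite mulr_ge0// mulr_ge0// normal_pdf_ge0.
    have n0 : 0 < n.+1%:R :> R by rewrite ltr0n.
    rewrite /harmonic standard_normal_pdfE; set x : R := n.+1%:R.
    (* From 1 + y <= exp y at y = x^2 / 2. This decay makes the boundary term of the integration by
       parts O(1 / x). *)
    have E1 : expR (- x ^+ 2 / 2) <= 2 / x ^+ 2.
      rewrite mulNr expRN -[leRHS]invrK lef_pV2 ?posrE ?expR_gt0 ?invr_gt0 ?divr_gt0 ?exprn_gt0//.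
      rewrite invf_div; apply: le_trans (expR_ge1Dx _); lra.
    have -> : 4 * normal_peak 1 * x^-1 = 2 * (x * (normal_peak 1 * (2 / x ^+ 2))).
      by field; rewrite gt_eqF.
    rewrite ler_pM2l// ler_pM2l// ler_wpM2l// normal_peak_ge0//.
  - exact: cvg_cst.
  - rewrite -[X in _ --> X](mulr0 (4 * normal_peak 1)); apply: cvgM; first exact: cvg_cst.
    exact: cvg_harmonic.
have c4 : ((\int[mu]_(x in I n) (x ^+ 2 * phi x)%R%:E + (2 * (n.+1%:R * phi n.+1%:R))%:E)%E)
     @[n --> \oo] --> (\int[mu]_x ((x ^+ 2)%:E * (phi x)%:E) + 0%:E)%E.
  apply: cvgeD => //; first by rewrite fin_num_adde_defl.
  by apply: cvg_EFin; [exact: nearW|exact: c3].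
have c5 := cvg_unique _ c4.
have /c5 : ((\int[mu]_(x in I n) (x ^+ 2 * phi x)%R%:E + (2 * (n.+1%:R * phi n.+1%:R))%:E)%E)
     @[n --> \oo] --> 1%E.
  by under eq_fun => n do rewrite integral_sqr_pdf_segment// ?ltr0n//.
by rewrite adde0 => ->.
Unshelve. all: by end_near. Qed.

End GaussianSecondMoment.

(** * Almost sure limits of Gaussian variables and their moments *)

Section GaussianLimits.
Context {d : measure_display} {Omega : measurableType d} {R : realType}.
Variable P : probability Omega R.
Local Notation gauss := (@normal_prob R 0 1).
Implicit Types (f : R -> R) (s M : R) (Z : Omega -> R).

(** Bounded continuous test functions are what passes to almost sure limits by dominated
    convergence. They also determine the moments below and are all that convergence in distribution
    tests. *)
Definition weakly_gaussian Z s := measurable_fun [set: Omega] Z /\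
  forall f M, continuous f -> (forall x, `|f x| <= M) ->
    (\int[P]_w (f (Z w))%:E = \int[gauss]_x (f (s * x))%:E)%E.

Lemma bounded_integrable {d'} {T : measurableType d'} (m : probability T R) (g : T -> R) M :
  measurable_fun [set: T] g -> (forall x, `|g x| <= M) ->
  m.-integrable [set: T] (EFin \o g).
Proof.
move=> mg gM; apply: measurable_bounded_integrable => //.
  by rewrite [X in (X < _)%E]probability_setT ltry.
by exists M; split; [exact: num_real|move=> y My x _; exact: le_trans (gM x) (ltW My)].
Qed.

Lemma bounded_convergence {d'} {T : measurableType d'} (m : probability T R)
    (g_ : nat -> T -> R) (g : T -> R) M :
  (forall n, measurable_fun [set: T] (g_ n)) -> measurable_fun [set: T] g ->
  (forall n x, `|g_ n x| <= M) ->
  {ae m, forall x, g_ n x @[n --> \oo] --> g x} ->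
  (\int[m]_x (g_ n x)%:E)%E @[n --> \oo] --> (\int[m]_x (g x)%:E)%E.
Proof.
move=> mg_ mg gM gg.
have [] := @dominated_convergence _ _ _ m setT measurableT (fun n => EFin \o g_ n)
  (EFin \o g) (cst M%:E) => //.
- by move=> n; exact/measurable_EFinP.
- exact/measurable_EFinP.
- apply: filterS gg => x gx _; apply: cvg_EFin; first exact: nearW.
  exact: gx.
- by apply: (bounded_integrable m (cst M) `|M|).
- by apply: aeW => x n _; rewrite lee_fin.
Qed.

Lemma is_gaussian_integral Z s f M : is_gaussian P Z s ->
  measurable_fun [set: R] f -> (forall x, `|f x| <= M) ->
  (\int[P]_w (f (Z w))%:E = \int[gauss]_x (f (s * x))%:E)%E.
Proof.
move=> [mZ lawZ] mf fM.
have ms := measurable_scale s.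
have mfE : measurable_fun [set: R] (EFin \o f) by exact/measurable_EFinP.
transitivity (\int[image_measure (T2 := measurableTypeR R) P mZ]_x (f x)%:E)%E.
  apply/esym.
  apply: (@integral_pushforward _ _ _ (measurableTypeR R) R _ mZ P setT _ mfE _ measurableT).
  apply: (bounded_integrable P (f \o Z) M) => [|x]; last exact: fM.
  exact: (measurableT_comp mf mZ).
transitivity (\int[image_measure (T1 := measurableTypeR R) (T2 := measurableTypeR R)
    gauss ms]_x (f x)%:E)%E.
  by apply: eq_measure_integral => B mB _; exact: lawZ.
apply: (@integral_pushforward _ _ (measurableTypeR R) (measurableTypeR R) R _ ms gauss
  setT _ mfE _ measurableT).
apply: (@bounded_integrable _ (measurableTypeR R) gauss (fun x => f (s * x)) M) => [|x].
  exact: (measurableT_comp mf ms).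
exact: fM.
Qed.

(** The law of S_ n is an image of one fixed law under multiplication by s_ n. Bounded convergence
    applies on Omega and on the line alike, and uniqueness of limits identifies the two
    integrals. *)
Lemma gaussian_limit (S_ : nat -> Omega -> R) (s_ : nat -> R) Z s :
  (forall n, is_gaussian P (S_ n) (s_ n)) -> measurable_fun [set: Omega] Z ->
  {ae P, forall w, S_ n w @[n --> \oo] --> Z w} -> s_ n @[n --> \oo] --> s ->
  weakly_gaussian Z s.
Proof.
move=> gS mZ SZ ss; split=> // f M cf fM.
have mf : measurable_fun [set: R] f by exact: continuous_measurable_fun.
have lim1 : (\int[P]_w (f (S_ n w))%:E)%E @[n --> \oo] --> (\int[P]_w (f (Z w))%:E)%E.
  apply: (bounded_convergence P (fun n w => f (S_ n w)) (f \o Z) M).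
  - by move=> n; exact: (measurableT_comp mf (gS n).1).
  - exact: (measurableT_comp mf mZ).
  - by move=> n w; exact: fM.
  - by apply: filterS SZ => w SwZ; apply: (cvg_comp _ _ SwZ); exact: cf.
have lim2 : (\int[P]_w (f (S_ n w))%:E)%E @[n --> \oo] --> (\int[gauss]_x (f (s * x))%:E)%E.
  under eq_fun => n do rewrite (is_gaussian_integral _ _ _ _ (gS n) mf fM).
  apply: (@bounded_convergence _ (measurableTypeR R) gauss (fun n x => f (s_ n * x))
    (fun x => f (s * x)) M).
  - by move=> n; exact: (measurableT_comp mf (measurable_scale _)).
  - exact: (measurableT_comp mf (measurable_scale _)).
  - by move=> n x; exact: fM.
  - apply: aeW => x; apply: (cvg_comp (fun n => s_ n * x)); last exact: cf.
    by apply: cvgM => //; exact: cvg_cst.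
exact: (cvg_unique _ lim1 lim2).
Qed.

Lemma min_nat_cvg {d'} {T : measurableType d'} (m : {measure set T -> \bar R}) (g : T -> R) :
  measurable_fun [set: T] g -> (forall x, 0 <= g x) ->
  (\int[m]_x (Num.min (g x) n%:R)%:E)%E @[n --> \oo] --> (\int[m]_x (g x)%:E)%E.
Proof.
move=> mg g0.
have c := @cvg_monotone_convergence _ T R m setT measurableT
  (fun n x => (Num.min (g x) n%:R)%:E).
rewrite [X in _ --> X](_ : _ =
    \int[m]_x (limn (fun n => (Num.min (g x) n%:R)%:E)))%E; last first.
  apply: eq_integral => x _; apply/esym/cvg_lim => //.
  apply: cvg_EFin; first exact: nearW.
  apply: cvg_near_cst; near=> n.
  apply/eqP; rewrite /= minElt; case: ltP => // gn; rewrite eq_le gn /=.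
  by near: n; exact: nbhs_infty_ger.
apply: c.
- move=> n; apply/measurable_EFinP.
  by apply: measurable_minr => //; exact: measurable_cst.
- by move=> n x _; rewrite lee_fin le_min g0 ler0n.
- move=> x _ a b ab; rewrite lee_fin le_min ge_min lexx /=.
  by rewrite ge_min ler_nat ab orbT.
Unshelve. all: by end_near. Qed.

(** The truncations min(g, n) are bounded and continuous; monotone convergence on both sides removes
    the truncation. *)
Lemma weakly_gaussian_ge0_integral Z s (g : R -> R) : weakly_gaussian Z s ->
  continuous g -> (forall x, 0 <= g x) ->
  (\int[P]_w (g (Z w))%:E = \int[gauss]_x (g (s * x))%:E)%E.
Proof.
move=> [mZ gZ] cg g0.
have mg : measurable_fun [set: R] g by exact: continuous_measurable_fun.
have lim1 := min_nat_cvg P (g \o Z) (measurableT_comp mg mZ) (fun w => g0 _).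
have lim2 := @min_nat_cvg _ (measurableTypeR R) gauss (fun x => g (s * x))
  (measurableT_comp mg (measurable_scale s)) (fun w => g0 _).
pose A n := (\int[P]_w (Num.min (g (Z w)) n%:R)%:E)%E.
pose B n := (\int[gauss]_x (Num.min (g (s * x)) n%:R)%:E)%E.
suff AB : A = B.
  have lim3 : B n @[n --> \oo] --> (\int[P]_w (g (Z w))%:E)%E by rewrite -AB; exact: lim1.
  exact: (cvg_unique _ lim3 lim2).
apply/funext => n; apply: (gZ (fun x => Num.min (g x) n%:R) n%:R).
  by apply: (min_fun_continuous cg) => x; exact: cvg_cst.
by move=> x; rewrite ger0_norm ?ge_min ?lexx ?orbT// le_min g0 ler0n.
Qed.

Lemma weakly_gaussian_second_moment Z s : weakly_gaussian Z s ->
  (\int[P]_w (Z w ^+ 2)%:E = (s ^+ 2)%:E)%E.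
Proof.
move=> gZ.
rewrite (weakly_gaussian_ge0_integral Z s (fun x => x ^+ 2) gZ); last 2 first.
- exact: sqr_continuous.
- by move=> x; exact: sqr_ge0.
under eq_integral do rewrite exprMn EFinM.
rewrite ge0_integralZl//; last 2 first.
- by move=> x _; rewrite lee_fin sqr_ge0.
- by rewrite lee_fin sqr_ge0.
- by rewrite gauss_second_moment mule1.
by apply/measurable_EFinP; exact: measurable_funX.
Qed.

Lemma weakly_gaussian_integrable Z s : weakly_gaussian Z s ->
  P.-integrable [set: Omega] (EFin \o Z).
Proof.
move=> gZ; have [mZ _] := gZ; apply/integrableP; split; first exact/measurable_EFinP.
apply: (@le_lt_trans _ _ (\int[P]_w (1 + (Z w ^+ 2)%:E))%E).
  apply: ge0_le_integral => //.
  - by apply/measurable_EFinP; apply: measurableT_comp.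
  - apply: emeasurable_funD => //; apply/measurable_EFinP; exact: measurable_funX.
  - move=> w _ /=; rewrite -EFinD lee_fin ler_norml.
    by apply/andP; split; have := sqr_ge0 (Z w - 1); have := sqr_ge0 (Z w + 1);
      rewrite sqrrB sqrrD; lra.
rewrite ge0_integralD//; last 2 first.
- by move=> w _; rewrite lee_fin sqr_ge0.
- by apply/measurable_EFinP; exact: measurable_funX.
rewrite (weakly_gaussian_second_moment _ _ gZ) integral_cst// mul1e.
by rewrite [X in (X + _)%E]probability_setT -EFinD ltry.
Qed.

(** Positive and negative parts are continuous nonnegative test functions with equal integrals by
    symmetry; these are finite, so their difference is 0. *)
Lemma weakly_gaussian_mean Z s : weakly_gaussian Z s ->
  (\int[P]_w (Z w)%:E = 0)%E.
Proof.
move=> gZ.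
have cp : continuous (fun x : R => Num.max x 0).
  by apply: max_fun_continuous => x; [exact: cvg_id|exact: cvg_cst].
have cn : continuous (fun x : R => Num.max (- x) 0).
  by apply: max_fun_continuous => x; [exact: opp_continuous|exact: cvg_cst].
rewrite integralE.
have -> : (\int[P]_w (fun w => (Z w)%:E)^\+ w = \int[P]_w (Num.max (Z w) 0)%:E)%E.
  by apply: eq_integral => w _; rewrite funeposE EFin_max.
have -> : (\int[P]_w (fun w => (Z w)%:E)^\- w = \int[P]_w (Num.max (- Z w) 0)%:E)%E.
  by apply: eq_integral => w _; rewrite funenegE EFin_max EFinN.
have fin : (\int[P]_w (Num.max (Z w) 0)%:E)%E \is a fin_num.
  have := integrable_fin_num measurableT
    (integrable_funepos measurableT (weakly_gaussian_integrable _ _ gZ)).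
  by congr (_ \is a fin_num); apply: eq_integral => w _; rewrite funeposE /= EFin_max.
suff -> : (\int[P]_w (Num.max (- Z w) 0)%:E = \int[P]_w (Num.max (Z w) 0)%:E)%E.
  by rewrite subee.
rewrite (weakly_gaussian_ge0_integral Z s _ gZ cp); last by move=> x; rewrite le_max lexx orbT.
rewrite (weakly_gaussian_ge0_integral Z s _ gZ cn); last by move=> x; rewrite le_max lexx orbT.
have mI (a : R) : measurable_fun [set: R] (fun x => (Num.max (a * x) 0)%:E : \bar R).
  apply/measurable_EFinP; apply: measurable_maxr => //; exact: measurable_scale.
have I0 (a : R) x : (0%R <= (Num.max (a * x) 0)%:E)%E by rewrite lee_fin le_max lexx orbT.
under eq_integral do rewrite -mulNr.
rewrite (ge0_integral_normal_prob 0 1 _ (mI (- s)) (I0 (- s))).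
rewrite (ge0_integral_normal_prob 0 1 _ (mI s) (I0 s)).
rewrite ge0_integral_opp; first last.
- by move=> x; rewrite mule_ge0// lee_fin normal_pdf_ge0.
- by apply: emeasurable_funM => //; apply/measurable_EFinP; exact: measurable_normal_pdf.
apply: eq_integral => x _; rewrite mulrNN; congr (_ * _%:E)%E.
by rewrite !standard_normal_pdfE sqrrN.
Qed.

End GaussianLimits.

(** * The oscillator along a fixed path *)

Section ContinuousOnSegment.
Context {R : realType}.
Local Notation mu := (@lebesgue_measure R).
Implicit Types (f : R -> R) (T s t : R).

Lemma heine f T (e : R) : {within `[0, T], continuous f} -> 0 < e ->
  exists2 eta : R, 0 < eta & forall s t, 0 <= s <= T -> 0 <= t <= T ->
    `|s - t| < eta -> `|f s - f t| <= e.
Proof.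
move=> cf e0; pose K : set R := `[0, T]%classic.
have cK : compact K by exact: segment_compact.
pose Q (eta x : R) := forall y : R, 0 <= y <= T -> `|x - y| < eta -> `|f x - f y| <= e.
have near_Q : \forall eta \near (0 : R)^'+, K `<=` Q eta.
  have FF : Filter (nbhs (0 : R)^'+) by exact: at_right_proper_filter.
  have H := (compact_near_coveringP K).1 cK R ((0 : R)^'+) (fun eta x => K x -> Q eta x) FF.
  apply: filterS (H _) => [eta HK x Kx|x Kx]; first exact: HK.
  have := (@subspace_continuousP _ K _ f).1 cf x Kx.
  move=> /cvgrPdist_lt /(_ (e / 2)); rewrite divr_gt0// => /(_ isT).
  rewrite near_withinE => /nbhs_ballP [r /= r0 fr].
  (* One half of r allows for the move from x to x', the other for the distance from x' to y. *)
  have r20 : 0 < r / 2 by rewrite divr_gt0.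
  near=> x' eta => Kx' y Ky xy; rewrite /= in Kx' xy *.
  have xx' : `|x - x'| < r / 2.
    by near: x'; exact: (nbhsx_ballx x (r / 2) r20).
  have er : eta < r / 2.
    by near: eta; exact: nbhs_right_lt.
  have d1 : `|f x - f x'| < e / 2.
    by apply: fr => //; rewrite /ball /=; lra.
  have d2 : `|f x - f y| < e / 2.
    apply: fr => //; rewrite /ball /=.
    have -> : x - y = (x - x') + (x' - y) by ring.
    by apply: (le_lt_trans (ler_normD _ _)); lra.
  have -> : f x' - f y = (f x - f y) - (f x - f x') by ring.
  by apply: (le_trans (ler_normB _ _)); lra.
have near_gt0 : \forall eta \near (0 : R)^'+, 0 < eta by exact: nbhs_right_gt.
have FP : ProperFilter (nbhs (0 : R)^'+) by exact: at_right_proper_filter.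
have := @filter_ex _ _ FP _ (filterI near_Q near_gt0).
case=> eta Heta; have Qeta := Heta.1; have eta0 : 0 < eta := Heta.2.
exists eta => // s t sT tT; apply: (Qeta s) => //.
Unshelve. all: by end_near. Qed.

Lemma segment_bounded f T : 0 <= T -> {within `[0, T], continuous f} ->
  exists2 B : R, 0 <= B & forall t, 0 <= t <= T -> `|f t| <= B.
Proof.
move=> T0 cf.
have [c _ cM] := EVT_max T0 cf; have [c' _ cm] := EVT_min T0 cf.
exists (`|f c| + `|f c'|); first by rewrite addr_ge0.
move=> t tT; have tin : t \in `[0, T] by rewrite in_itv.
have := cM _ tin; have := cm _ tin.
have := ler_norm (f c); have := ler_norm (- f c'); rewrite normrN.
have := normr_ge0 (f c); have := normr_ge0 (f c').
by move=> *; rewrite ler_norml; apply/andP; split; lra.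
Qed.

Lemma segment_integrable f T s : 0 <= s <= T -> {within `[0, T], continuous f} ->
  mu.-integrable `[0, s] (EFin \o f).
Proof.
move=> /andP[s0 sT] cf; apply: continuous_compact_integrable; first exact: segment_compact.
apply: continuous_subspaceW cf => x /=; rewrite !in_itv/= => /andP[-> xs] /=.
exact: le_trans sT.
Qed.

Lemma integral_increment f T s t (c e : R) : {within `[0, T], continuous f} ->
  0 <= s -> s <= t -> t <= T -> (forall x, s <= x <= t -> `|f x - c| <= e) ->
  `|Rintegral mu `[0, t] f - Rintegral mu `[0, s] f - (t - s) * c| <= (t - s) * e.
Proof.
move=> cf s0 st tT fc.
have t0 := le_trans s0 st.
have tT' : 0 <= t <= T by rewrite t0.
have ift := segment_integrable _ _ _ tT' cf.
rewrite Rintegral_itvB ?bnd_simp//; set I := Rintegral _ _ _.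
have sub : `]s, t] `<=` `[0, t].
  by move=> x /=; rewrite !in_itv/= => /andP[sx ->]; rewrite andbT (le_trans s0)// ltW.
have ist : mu.-integrable `]s, t] (EFin \o f).
  by apply: integrableS ift => //; exact: measurable_itv.
have icst (k : R) : mu.-integrable `]s, t] (EFin \o cst k).
  apply: (@integrableS _ _ _ mu `[0, t]) => //; try exact: measurable_itv.
  apply: continuous_compact_integrable; first exact: segment_compact.
  by apply: continuous_subspaceT => x; exact: cvg_cst.
have mul : fine (mu `]s, t]) = t - s.
  rewrite lebesgue_measure_itv/= lte_fin; case: ltP => // ts.
  have -> : t = s by apply/eqP; rewrite eq_le ts st.
  by rewrite subrr.
have up : I <= (t - s) * (c + e).
  rewrite [leRHS]mulrC -mul -Rintegral_cst//; apply: (le_Rintegral _ ist (icst (c + e))) => //.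
  move=> x /=; rewrite in_itv/= => /andP[sx xt].
  have := fc x; rewrite xt (ltW sx) => /(_ isT); rewrite ler_norml => /andP[? ?]; lra.
have lo : (t - s) * (c - e) <= I.
  rewrite [leLHS]mulrC -mul -Rintegral_cst//; apply: (le_Rintegral _ (icst (c - e)) ist) => //.
  move=> x /=; rewrite in_itv/= => /andP[sx xt].
  have := fc x; rewrite xt (ltW sx) => /(_ isT); rewrite ler_norml => /andP[? ?]; lra.
by clearbody I; rewrite ler_norml; apply/andP; split; lra.
Qed.

End ContinuousOnSegment.

Section OscillatorPath.
Context {R : realType}.
Local Notation mu := (@lebesgue_measure R).

Lemma shift_taylor (theta delta : R) : 0 <= delta <= 1 ->
  `|cos (theta - delta) - cos theta - delta * sin theta| <= 2 * delta ^+ 2 /\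
  `|sin (theta - delta) - sin theta + delta * cos theta| <= 2 * delta ^+ 2.
Proof.
move=> d01; have /andP[d0 d1] := d01.
have c := cos_taylor0 _ d01; have s := sin_taylor1 _ d01.
have {}s : `|sin delta - delta| <= delta ^+ 2.
  by apply: (le_trans s); rewrite exprSr ler_piMr ?sqr_ge0.
have -> : 2 * delta ^+ 2 = 1 * delta ^+ 2 + 1 * delta ^+ 2 by ring.
split.
- have -> : cos (theta - delta) - cos theta - delta * sin theta =
    cos theta * (cos delta - 1) + sin theta * (sin delta - delta).
    by rewrite cosB; ring.
  apply: (le_trans (ler_normD _ _)); apply: lerD; apply: ler_normM => //.
    exact: cos_max.
  exact: sin_max.
- have -> : sin (theta - delta) - sin theta + delta * cos theta =
    sin theta * (cos delta - 1) - cos theta * (sin delta - delta).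
    by rewrite sinB; ring.
  apply: (le_trans (ler_normB _ _)); apply: lerD; apply: ler_normM => //.
    exact: sin_max.
  exact: cos_max.
Qed.

Variables (x1 x2 beta : R -> R) (a b alpha T : R).
Hypothesis T_gt0 : 0 < T.
Hypothesis cx1 : {within `[0, T], continuous x1}.
Hypothesis cx2 : {within `[0, T], continuous x2}.
Hypothesis x1E : forall t, 0 <= t <= T -> x1 t = a + Rintegral mu `[0, t] x2.
Hypothesis x2E : forall t, 0 <= t <= T ->
  x2 t = b + Rintegral mu `[0, t] (fun s => - x1 s) + alpha * (beta t - beta 0).

(* Along a solution, y(t) = sin (T - t) x2(t) + cos (T - t) x1(t) satisfies
   dy = alpha sin (T - t) dbeta, y(T) = x1(T) and y(0) = b sin T + a cos T. *)
Let y (t : R) : R := sin (T - t) * x2 t + cos (T - t) * x1 t.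

Let y_step (t delta e B : R) : 0 <= t -> 0 < delta <= 1 -> t + delta <= T ->
  (forall s t, 0 <= s <= T -> 0 <= t <= T -> `|s - t| <= delta -> `|x1 s - x1 t| <= e) ->
  (forall s t, 0 <= s <= T -> 0 <= t <= T -> `|s - t| <= delta -> `|x2 s - x2 t| <= e) ->
  (forall t, 0 <= t <= T -> `|x1 t| <= B) -> (forall t, 0 <= t <= T -> `|x2 t| <= B) ->
  `|y (t + delta) - y t - alpha * sin (T - t) * (beta (t + delta) - beta t)|
  <= delta * (2 * e + 4 * B * delta).
Proof.
move=> t0 /andP[d0 d1] tT u1 u2 B1 B2.
have t'T : 0 <= t + delta <= T by rewrite tT andbT addr_ge0// ltW.
have tT' : 0 <= t <= T by rewrite t0/=; lra.
have tt' : t <= t + delta by lra.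
have cN : {within `[0, T], continuous (fun s => - x1 s)}.
  by move=> s; apply: continuousN; exact: cx1.
have near_t' s : t <= s <= t + delta -> `|s - (t + delta)| <= delta.
  by move=> /andP[? ?]; rewrite ler_norml; apply/andP; split; lra.
have i2 : `|Rintegral mu `[0, t + delta] x2 - Rintegral mu `[0, t] x2
    - delta * x2 (t + delta)| <= delta * e.
  have := integral_increment x2 T t (t + delta) (x2 (t + delta)) e cx2 t0 tt' tT.
  have -> : t + delta - t = delta by ring.
  apply=> s st; apply: u2 => //; last exact: near_t'.
  by move: st => /andP[? ?]; apply/andP; split; lra.
have i1 : `|Rintegral mu `[0, t + delta] (fun s => - x1 s)
    - Rintegral mu `[0, t] (fun s => - x1 s)
    - delta * (- x1 (t + delta))| <= delta * e.
  have := integral_increment (fun s => - x1 s) T t (t + delta) (- x1 (t + delta)) e cN t0 tt' tT.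
  have -> : t + delta - t = delta by ring.
  apply=> s st; rewrite -opprD normrN; apply: u1 => //; last exact: near_t'.
  by move: st => /andP[? ?]; apply/andP; split; lra.
have d01 : 0 <= delta <= 1 by rewrite ltW.
have [ec es] := shift_taylor (T - t) delta d01.
have TE : T - (t + delta) = T - t - delta by ring.
set r2 := (X in `|X| <= _) in i2; set r1 := (X in `|X| <= _) in i1.
set rc := (X in `|X| <= _) in ec; set rs := (X in `|X| <= _) in es.
(* All drift terms are evaluated at the right end t + delta. The first-order terms of the drift then
   cancel exactly against those of the rotating weights, and only the four remainders are left. *)
have -> : y (t + delta) - y t - alpha * sin (T - t) * (beta (t + delta) - beta t) =
  sin (T - t) * r1 + cos (T - t) * r2 + x1 (t + delta) * rc + x2 (t + delta) * rs.
  have e1 : x1 (t + delta) - x1 t = delta * x2 (t + delta) + r2.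
    by rewrite (x1E _ t'T) (x1E _ tT') /r2; ring.
  have e2 : x2 (t + delta) - x2 t =
      - delta * x1 (t + delta) + r1 + alpha * (beta (t + delta) - beta t).
    by rewrite (x2E _ t'T) (x2E _ tT') /r1; ring.
  have -> : y (t + delta) - y t - alpha * sin (T - t) * (beta (t + delta) - beta t) =
    sin (T - t) * (x2 (t + delta) - x2 t) + (sin (T - t - delta) - sin (T - t)) * x2 (t + delta)
    + cos (T - t) * (x1 (t + delta) - x1 t) + (cos (T - t - delta) - cos (T - t)) * x1 (t + delta)
    - alpha * sin (T - t) * (beta (t + delta) - beta t).
    by rewrite /y TE; ring.
  by rewrite e1 e2 /rc /rs; ring.
have n1 := ler_normM _ _ _ _ (sin_max (T - t)) i1.
have n2 := ler_normM _ _ _ _ (cos_max (T - t)) i2.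
have n3 := ler_normM _ _ _ _ (B1 _ t'T) ec.
have n4 := ler_normM _ _ _ _ (B2 _ t'T) es.
apply: (le_trans (ler_normD _ _)).
apply: le_trans (lerD (le_trans (ler_normD _ _)
  (lerD (le_trans (ler_normD _ _) (lerD n1 n2)) n3)) n4) _.
by rewrite le_eqVlt; apply/orP; left; apply/eqP; ring.
Qed.

Lemma oscillator_riemann_stieltjes :
  \sum_(j < M.+1) alpha * sin (T - j%:R * (T / M.+1%:R)) *
    (beta (j.+1%:R * (T / M.+1%:R)) - beta (j%:R * (T / M.+1%:R)))
  @[M --> \oo] --> x1 T - (a * cos T + b * sin T).
Proof.
have T0 := ltW T_gt0.
have [B1 B10 B1x] := segment_bounded x1 T T0 cx1.
have [B2 B20 B2x] := segment_bounded x2 T T0 cx2.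
pose B := B1 + B2.
have B0 : 0 <= B by rewrite addr_ge0.
have zT : 0 <= (0 : R) <= T by rewrite lexx.
have TT : 0 <= T <= T by rewrite T0 lexx.
have y0 : y 0 = b * sin T + a * cos T.
  rewrite /y subr0 (x1E _ zT) (x2E _ zT) set_itv1 !Rintegral_set1; ring.
have yT : y T = x1 T by rewrite /y subrr sin0 cos0 mul0r add0r mul1r.
have -> : x1 T - (a * cos T + b * sin T) = y T - y 0 by rewrite yT y0; ring.
apply/cvgrPdist_le => e e0.
(* The step bounds sum to T (2 e' + 4 B delta). The oscillation part is e / 2, and [d4] below keeps
   the rest under e / 2, with B + 1 to avoid dividing by 0. *)
pose e' := e / (4 * T).
have e'0 : 0 < e' by rewrite divr_gt0// mulr_gt0.
have [h1 h10 H1] := heine x1 T e' cx1 e'0.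
have [h2 h20 H2] := heine x2 T e' cx2 e'0.
have Tharm : (T / M.+1%:R) @[M --> \oo] --> (0 : R).
  rewrite -[X in _ --> X](mulr0 T); apply: cvgM; first exact: cvg_cst.
  exact: cvg_harmonic.
have small (h : R) : 0 < h -> \forall M \near \oo, T / M.+1%:R < h.
  move=> hh; have := cvgr_lt 0 Tharm h hh; exact.
have e8 : 0 < e / (8 * T * (B + 1)) by rewrite divr_gt0// !mulr_gt0//; lra.
near=> M.
have d1 : T / M.+1%:R < h1 by near: M; exact: small.
have d2 : T / M.+1%:R < h2 by near: M; exact: small.
have d3 : T / M.+1%:R < 1 by near: M; exact: small.
have d4 : T / M.+1%:R < e / (8 * T * (B + 1)) by near: M; exact: small.
set delta := T / M.+1%:R in d1 d2 d3 d4 *.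
have M0 : 0 < M.+1%:R :> R by rewrite ltr0n.
have d0 : 0 < delta by rewrite divr_gt0.
have MdT : M.+1%:R * delta = T by rewrite /delta mulrC divfK// gt_eqF.
have -> : y T - y 0 = \sum_(j < M.+1) (y (j.+1%:R * delta) - y (j%:R * delta)).
  rewrite -(big_mkord xpredT (fun j => y (j.+1%:R * delta) - y (j%:R * delta))).
  by rewrite telescope_sumr// MdT mul0r.
rewrite -sumrB; apply: (le_trans (ler_norm_sum _ _ _)).
apply: (@le_trans _ _ (\sum_(j < M.+1) (delta * (2 * e' + 4 * B * delta)))); last first.
  rewrite sumr_const card_ord -[leLHS]mulr_natl mulrA MdT.
  have -> : T * (2 * e' + 4 * B * delta) = e / 2 + 4 * T * B * delta.
    by rewrite /e'; field; rewrite gt_eqF.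
  have : 4 * T * B * delta <= 4 * T * (B + 1) * (e / (8 * T * (B + 1))).
    apply: ler_pM; rewrite ?mulr_ge0// ?ltW//.
    by rewrite ltr_pM2l ?mulr_gt0//; lra.
  have -> : 4 * T * (B + 1) * (e / (8 * T * (B + 1))) = e / 2.
    by field; rewrite !gt_eqF//; lra.
  by lra.
apply: ler_sum => /= j _.
have jd0 : 0 <= j%:R * delta by rewrite mulr_ge0// ltW.
have jE : j.+1%:R * delta = j%:R * delta + delta by rewrite -natr1; ring.
have jT : j%:R * delta + delta <= T.
  by rewrite -jE -MdT ler_wpM2r ?(ltW d0)// ler_nat.
have d01 : 0 < delta <= 1 by rewrite d0 ltW.
rewrite jE; apply: (y_step _ delta e' B jd0 d01 jT).
- by move=> s t sT tT st; apply: H1 => //; exact: le_lt_trans d1.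
- by move=> s t sT tT st; apply: H2 => //; exact: le_lt_trans d2.
- by move=> t tT; apply: (le_trans (B1x t tT)); rewrite lerDl.
- by move=> t tT; apply: (le_trans (B2x t tT)); rewrite lerDr.
Unshelve. all: by end_near. Qed.

End OscillatorPath.

(** * The error on refined grids *)

Section SchemeExpansion.
Context {d : measure_display} {Omega : measurableType d} {R : realType}.
Context {P : probability Omega R}.
Implicit Types (h alpha T : R) (W : R -> {RV P >-> R}) (v : 'cV[R]_2) (k n N : nat).

Lemma mx2_mulmx (a b c e : R) v :
  (mx2 a b c e *m v) 0 0 = a * v 0 0 + b * v 1 0 /\
  (mx2 a b c e *m v) 1 0 = c * v 0 0 + e * v 1 0.
Proof.
have E : lift ord0 ord0 = 1 :> 'I_2 by apply: val_inj.
by split; rewrite mxE !big_ord_recl big_ord0 !mxE /= E addr0.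
Qed.

Lemma pc_coefE h n :
  pc_coef h n = ((iter n (mulmx (pc_matrix h)) (pc_noise h)) 0 0,
                 (iter n (mulmx (pc_matrix h)) (pc_noise h)) 1 0).
Proof.
elim: n => [|n IH]; first by rewrite /= /pc_noise /cv2 !mxE.
by rewrite /= IH; have [-> ->] := mx2_mulmx (1 - h ^+ 2) h (- h) (1 - h ^+ 2)
  (iter n (mulmx (pc_matrix h)) (pc_noise h)).
Qed.

Lemma pc_em_bem_expansion alpha h (x0 : 'cV[R]_2) W k w :
  pc_em_bem alpha h x0 W k w = iter k (mulmx (pc_matrix h)) x0 +
  \sum_(i < k) (alpha * (W (i.+1%:R * h) w - W (i%:R * h) w)) *:
    iter (k - i.+1) (mulmx (pc_matrix h)) (pc_noise h).
Proof.
elim: k => [|k IH]; first by rewrite big_ord0 addr0.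
rewrite big_ord_recr /= subnn IH mulmxDr mulmx_sumr addrA; congr (_ + _ + _).
apply: eq_bigr => i _; rewrite -scalemxAr; congr (_ *: _).
by rewrite subSn.
Qed.

End SchemeExpansion.

Section FineGrid.
Context {R : realType}.
Implicit Types (T alpha h : R) (N m : nat) (b : R -> R).

Lemma sum_blocks (F : nat -> R) N m :
  \sum_(j < N * m) F j = \sum_(k < N) \sum_(i < m) F (k * m + i)%N.
Proof.
rewrite -(big_mkord xpredT F) big_nat_mul big_mkord; apply: eq_bigr => k _.
rewrite -{1}[(k * m)%N]add0n big_addn mulSn addnK big_mkord.
by apply: eq_bigr => i _; rewrite addnC.
Qed.

Definition grid_step T N m : R := T / (N * m.+1)%:R.

(** Every step of the scheme is cut into m + 1 parts, so the quotient of j by m + 1 is the scheme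
    step k containing fine interval j. The noise of step k is later multiplied N - (k + 1) times by
    the matrix. *)
Definition grid_weight alpha T N m j : R :=
  alpha * ((pc_coef (T / N%:R) (N - (j %/ m.+1).+1)).1 - sin (T - j%:R * grid_step T N m)).

Lemma grid_step_refine T N m : (0 < N)%N -> m.+1%:R * grid_step T N m = T / N%:R.
Proof.
move=> N0; rewrite /grid_step natrM.
have : N%:R != 0 :> R by rewrite pnatr_eq0 -lt0n.
have : m.+1%:R != 0 :> R by rewrite pnatr_eq0.
by set M := m.+1%:R; clearbody M => *; field; apply/andP; split.
Qed.

(** The scheme coefficient is constant on each block of m + 1 fine intervals, whose increments
    telescope to the increment used by the scheme. *)
Lemma grid_sumE alpha T N m b : (0 < N)%N ->
  \sum_(j < N * m.+1) grid_weight alpha T N m j *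
    (b (j.+1%:R * grid_step T N m) - b (j%:R * grid_step T N m)) =
  alpha * (\sum_(k < N) (pc_coef (T / N%:R) (N - k.+1)).1 *
             (b (k.+1%:R * (T / N%:R)) - b (k%:R * (T / N%:R))))
  - \sum_(j < N * m.+1) alpha * sin (T - j%:R * grid_step T N m) *
    (b (j.+1%:R * grid_step T N m) - b (j%:R * grid_step T N m)).
Proof.
move=> N0; set dl := grid_step T N m; set h := T / N%:R.
have hE : m.+1%:R * dl = h by exact: grid_step_refine.
rewrite (eq_bigr (fun j : 'I__ => alpha * (pc_coef h (N - (j %/ m.+1).+1)).1 *
    (b (j.+1%:R * dl) - b (j%:R * dl)) -
    alpha * sin (T - j%:R * dl) * (b (j.+1%:R * dl) - b (j%:R * dl)))); last first.
  by move=> j _; rewrite /grid_weight -/h -/dl; ring.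
rewrite sumrB; congr (_ - _).
rewrite (sum_blocks (fun j => alpha * (pc_coef h (N - (j %/ m.+1).+1)).1 *
  (b (j.+1%:R * dl) - b (j%:R * dl)))) mulr_sumr.
apply: eq_bigr => k _.
transitivity (\sum_(i < m.+1) alpha * (pc_coef h (N - k.+1)).1 *
   (b ((k * m.+1 + i).+1%:R * dl) - b ((k * m.+1 + i)%:R * dl))).
  by apply: eq_bigr => i _; rewrite divnMDl// divn_small// addn0.
rewrite -mulr_sumr mulrA; congr (_ * _).
rewrite -(big_mkord xpredT (fun i => b ((k * m.+1 + i).+1%:R * dl) - b ((k * m.+1 + i)%:R * dl))).
under eq_bigr do rewrite -addnS.
rewrite (telescope_sumr (fun i => b ((k * m.+1 + i)%:R * dl)))// addn0.
by rewrite -mulSnr !natrM -!mulrA hE.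
Qed.

Lemma grid_variance_cvg alpha T N : 0 < T -> (0 < N)%N ->
  \sum_(j < N * m.+1) grid_weight alpha T N m j ^+ 2 *
    (j.+1%:R * grid_step T N m - j%:R * grid_step T N m) @[m --> \oo]
  --> alpha ^+ 2 * residual_variance (T / N%:R) N.
Proof.
move=> T0 N0; set h := T / N%:R.
have N0' : 0 < N%:R :> R by rewrite ltr0n.
have h0 : 0 < h by rewrite divr_gt0.
have NhT : N%:R * h = T by rewrite /h mulrC divfK// gt_eqF.
pose C := alpha ^+ 2 * h ^+ 2 * \sum_(k < N) (2 * `|(pc_coef h (N - k.+1)).1| + 2).
have C0 : 0 <= C.
  apply: mulr_ge0; first by rewrite mulr_ge0 ?sqr_ge0.
  by apply: sumr_ge0 => k _; rewrite addr_ge0// mulr_ge0.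
have bound m : `|alpha ^+ 2 * residual_variance h N -
    \sum_(j < N * m.+1) grid_weight alpha T N m j ^+ 2 *
    (j.+1%:R * grid_step T N m - j%:R * grid_step T N m)| <= C * m.+1%:R^-1.
  set dl := grid_step T N m.
  have hE : m.+1%:R * dl = h by exact: grid_step_refine.
  have m0 : 0 < m.+1%:R :> R by rewrite ltr0n.
  have dl0 : 0 <= dl by rewrite divr_ge0// ltW.
  have -> : \sum_(j < N * m.+1) grid_weight alpha T N m j ^+ 2 * (j.+1%:R * dl - j%:R * dl) =
    alpha ^+ 2 * \sum_(k < N) \sum_(i < m.+1) dl *
      ((pc_coef h (N - k.+1)).1 - sin ((N - k)%:R * h - i%:R * dl)) ^+ 2.
    rewrite (sum_blocks (fun j => grid_weight alpha T N m j ^+ 2 * (j.+1%:R * dl - j%:R * dl))).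
    rewrite mulr_sumr; apply: eq_bigr => k _; rewrite mulr_sumr; apply: eq_bigr => i _.
    rewrite /grid_weight -/h -/dl divnMDl// divn_small// addn0.
    have -> : T - (k * m.+1 + i)%:R * dl = (N - k)%:R * h - i%:R * dl.
      rewrite natrD natrM natrB; last exact: ltnW.
      by rewrite -hE in NhT *; rewrite -NhT; ring.
    by rewrite -natr1; ring.
  (* The cells of [residual_variance] are numbered by time remaining, the blocks of the grid by time
     elapsed. *)
  rewrite /residual_variance (reindex_inj rev_ord_inj) /=.
  rewrite -mulrBr -sumrB normrM ger0_norm ?sqr_ge0//.
  have -> : C * m.+1%:R^-1 = alpha ^+ 2 * (h ^+ 2 / m.+1%:R *
      \sum_(k < N) (2 * `|(pc_coef h (N - k.+1)).1| + 2)) by rewrite /C; ring.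
  rewrite ler_wpM2l ?sqr_ge0// mulr_sumr.
  apply: (le_trans (ler_norm_sum _ _ _)); apply: ler_sum => k _.
  rewrite distrC.
  have -> : (N - k.+1).+1 = (N - k)%N by rewrite subnSK.
  have -> : (N - k.+1)%:R * h = (N - k)%:R * h - m.+1%:R * dl.
    by rewrite hE -(subnSK (ltn_ord k)) -natr1; ring.
  apply: (le_trans (residual_riemann _ _ _ _ dl0)).
  rewrite -hE le_eqVlt; apply/orP; left; apply/eqP; field.
  by rewrite gt_eqF.
apply/cvgrPdist_le => e e0; near=> m; apply: (le_trans (bound m)).
have : m.+1%:R^-1 < e / (C + 1).
  near: m.
  have e1 : 0 < e / (C + 1) by rewrite divr_gt0// ltr_wpDl.
  exact: (cvgr_lt (0 : R) (@cvg_harmonic R) _ e1).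
rewrite ltr_pdivlMr ?ltr_wpDl// => H.
apply: le_trans (ltW H); rewrite mulrC ler_wpM2l// ?invr_ge0//; lra.
Unshelve. all: by end_near. Qed.

Lemma residual_variance_ge0 h N : 0 <= h -> 0 <= residual_variance h N.
Proof.
move=> h0; apply: sumr_ge0 => n _.
have st : n%:R * h <= n.+1%:R * h by rewrite ler_wpM2r// ler_nat.
have [c _ ->] := derive_mean_value _ _ _ _ st (is_derive_residual_primitive (pc_coef h n).1).
by rewrite mulr_ge0 ?sqr_ge0// subr_ge0.
Qed.

End FineGrid.

(** * Law and variance of the error *)

Section GaussianError.
Context {R : realType} {d : measure_display} {Omega : measurableType d}.
Variable P : probability Omega R.
Variables (alpha T : R) (x0 : 'cV[R]_2) (W : R -> {RV P >-> R}) (X : R -> Omega -> 'cV[R]_2).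
Hypothesis T_gt0 : 0 < T.
Hypothesis W_brownian : is_brownian_motion W.
Hypothesis X_solution : is_oscillator_solution alpha T x0 W X.
Local Notation gauss := (@normal_prob R 0 1).

Let e := pc_error alpha T x0 W X.

Definition error_mean N : R :=
  (iter N (mulmx (pc_matrix (T / N%:R))) x0) 0 0 - (x0 0 0 * cos T + x0 1 0 * sin T).

Definition error_sd N : R := Num.sqrt (alpha ^+ 2 * residual_variance (T / N%:R) N).

Lemma oscillator_grid_cvg : {ae P, forall w,
  \sum_(j < M.+1) alpha * sin (T - j%:R * (T / M.+1%:R)) *
    (W (j.+1%:R * (T / M.+1%:R)) w - W (j%:R * (T / M.+1%:R)) w)
  @[M --> \oo] --> X T w 0 0 - (x0 0 0 * cos T + x0 1 0 * sin T)}.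
Proof.
have [_ cX eqX] := X_solution.
apply: filterS2 cX eqX => w cX eqX.
apply: (oscillator_riemann_stieltjes (fun t => X t w 0 0) (fun t => X t w 1 0)
  (fun t => W t w)) => //.
- move=> t tT; rewrite (eqX t 0 tT) /oscillator_noise /cv2 !mxE mulr0 addr0.
  congr (_ + _); apply: eq_Rintegral => s _.
  by have [-> _] := mx2_mulmx 0 1 (-1) 0 (X s w); rewrite mul0r add0r mul1r.
- move=> t tT; rewrite (eqX t 1 tT) /oscillator_noise /cv2 !mxE mulr1.
  congr (_ + _ + _); apply: eq_Rintegral => s _.
  by have [_ ->] := mx2_mulmx 0 1 (-1) 0 (X s w); rewrite mul0r addr0 mulN1r.
Qed.

Lemma measurable_pc_em_bem h k (i : 'I_2) :
  measurable_fun [set: Omega] (fun w => pc_em_bem alpha h x0 W k w i 0).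
Proof.
under eq_fun do rewrite pc_em_bem_expansion !mxE summxE.
apply: measurable_funD => //; apply: measurable_sum => j.
under eq_fun do rewrite mxE.
apply: measurable_funM => //; apply: measurable_funM => //.
exact: measurable_funB.
Qed.

Lemma measurable_pc_error N : measurable_fun [set: Omega] (e N).
Proof.
apply: measurable_funB; first exact: measurable_pc_em_bem.
have [mX _ _] := X_solution; apply: mX.
by rewrite lexx ltW.
Qed.

Lemma pc_error_gaussian N : (0 < N)%N ->
  weakly_gaussian P (fun w => e N w - error_mean N) (error_sd N).
Proof.
move=> N0.
pose S m w := \sum_(j < N * m.+1) grid_weight alpha T N m j *
  (W (j.+1%:R * grid_step T N m) w - W (j%:R * grid_step T N m) w).
pose s m := Num.sqrt (\sum_(j < N * m.+1) grid_weight alpha T N m j ^+ 2 *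
    (j.+1%:R * grid_step T N m - j%:R * grid_step T N m)).
apply: (gaussian_limit P S s).
- move=> m; apply: (brownian_sum_gaussian W (N * m.+1)
    (fun j => j%:R * grid_step T N m) (grid_weight alpha T N m)) => //.
    by rewrite mul0r.
  move=> i; rewrite ltr_pM2r ?ltr_nat// divr_gt0// ltr0n muln_gt0 N0 //.
- by apply: measurable_funB => //; exact: measurable_pc_error.
- apply: filterS oscillator_grid_cvg => w cvgw.
  pose c := alpha * (\sum_(k < N) (pc_coef (T / N%:R) (N - k.+1)).1 *
             (W (k.+1%:R * (T / N%:R)) w - W (k%:R * (T / N%:R)) w)).
  have -> : e N w - error_mean N = c - (X T w 0 0 - (x0 0 0 * cos T + x0 1 0 * sin T)).
    rewrite /e /pc_error pc_em_bem_expansion !mxE summxE /error_mean.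
    have -> : \sum_(i < N) ((alpha * (W (i.+1%:R * (T / N%:R)) w - W (i%:R * (T / N%:R)) w)) *:
       iter (N - i.+1) (mulmx (pc_matrix (T / N%:R))) (pc_noise (T / N%:R))) 0 0 = c.
      rewrite /c mulr_sumr; apply: eq_bigr => i _.
      by rewrite mxE pc_coefE /=; ring.
    by ring.
  under eq_fun => m do rewrite /S (grid_sumE alpha T N m (fun t => W t w) N0).
  apply: cvgB; first exact: cvg_cst.
  (* The Riemann-Stieltjes sums are indexed by M with M + 1 intervals; the grids refining that of
     the scheme form the subsequence M = N (m + 1) - 1. *)
  have Nm m : (N * m.+1)%N = (N * m.+1).-1.+1 by rewrite prednK// muln_gt0 N0.
  have sub : (N * m.+1).-1 @[m --> \oo] --> \oo.
    apply/cvgnyPge => A; near=> m.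
    rewrite -ltnS prednK ?muln_gt0 ?N0//.
    apply: (@leq_trans m.+1); last by rewrite leq_pmull.
    by rewrite ltnS; near: m; exact: nbhs_infty_ge.
  have := cvg_comp _ _ sub cvgw.
  rewrite [X in X @ _ --> _ -> _](_ : _ = (fun m => \sum_(j < N * m.+1) alpha *
     sin (T - j%:R * grid_step T N m) * (W (j.+1%:R * grid_step T N m) w -
     W (j%:R * grid_step T N m) w))) //.
  by apply/funext => m; rewrite /= /grid_step; rewrite -Nm.
- apply: (cvg_comp _ Num.sqrt (grid_variance_cvg alpha T N T_gt0 N0)).
  exact: sqrt_continuous.
Unshelve. all: by end_near. Qed.

Lemma weakly_gaussian_expectation (Z : Omega -> R) (s a b : R) : weakly_gaussian P Z s ->
  'E_P[fun w => (a * Z w + b)%R]%E = b%:E.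
Proof.
move=> gZ; have iZ := weakly_gaussian_integrable _ _ _ gZ.
rewrite unlock; under eq_integral do rewrite EFinD EFinM.
rewrite integralD//=; last 2 first.
- exact: integrableZl.
- exact: finite_measure_integrable_cst.
rewrite integralZl//= (weakly_gaussian_mean _ _ _ gZ) mule0 add0e.
by rewrite integral_cst// [X in (_ * X)%E]probability_setT mule1.
Qed.

Lemma pc_error_variance N : (0 < N)%N ->
  'V_P[e N]%E = (alpha ^+ 2 * residual_variance (T / N%:R) N)%:E.
Proof.
move=> N0; have gZ := pc_error_gaussian N N0.
have E1 : ('E_P[e N] = (error_mean N)%:E)%E.
  rewrite -(weakly_gaussian_expectation _ _ 1 (error_mean N) gZ).
  by congr expectation; apply/funext => w; rewrite mul1r subrK.
have rv0 : 0 <= residual_variance (T / N%:R) N.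
  by apply: residual_variance_ge0; rewrite divr_ge0// ltW.
have -> : alpha ^+ 2 * residual_variance (T / N%:R) N = error_sd N ^+ 2.
  by rewrite sqr_sqrtr// mulr_ge0// sqr_ge0.
rewrite -(weakly_gaussian_second_moment _ _ _ gZ).
rewrite /variance covariance.unlock E1 expectation.unlock /=.
by apply: eq_integral => w _; rewrite expr2.
Qed.

End GaussianError.

(** * Convergence in distribution *)

Section CentralLimit.
Context {R : realType}.
Local Notation gauss := (@normal_prob R 0 1).

(** Under [normal_prob 0 s] the identity is itself a Gaussian variable of scale s, so the integral
    formula for Gaussian variables applies. *)
Lemma normal_prob_integral (s M : R) (f : R -> R) : 0 < s -> continuous f ->
  (forall x, `|f x| <= M) ->
  (\int[normal_prob 0 s]_x (f x)%:E = \int[gauss]_x (f (s * x))%:E)%E.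
Proof.
move=> s0 cf fM.
have mid : measurable_fun [set: measurableTypeR R] (idfun : R -> R).
  exact: measurable_id.
have gid : is_gaussian (normal_prob (0 : R) s) (idfun : R -> R) s.
  by split=> // B mB; exact: normal_prob_scale.
have mf : measurable_fun [set: R] f by exact: continuous_measurable_fun.
exact: (is_gaussian_integral _ _ _ _ _ gid mf fM).
Qed.

Lemma scaled_sd_cvg (alpha T : R) : 0 < T ->
  N%:R * error_sd alpha T N @[N --> \oo] -->
  Num.sqrt (alpha ^+ 2 * T ^+ 2 * error_constant T).
Proof.
move=> T0; have [C C0 HC] := residual_variance_expansion T T0.
have E N : (0 < N)%N -> N%:R * error_sd alpha T N =
    Num.sqrt (alpha ^+ 2 * (N%:R ^+ 2 * residual_variance (T / N%:R) N)).
  move=> N0; rewrite /error_sd.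
  rewrite mulrCA [RHS]sqrtrM ?sqr_ge0// sqrtr_sqr ger0_norm// .
have harm : (T / N%:R) @[N --> \oo] --> (0 : R).
  rewrite -[X in _ --> X](mulr0 T); apply: cvgM; first exact: cvg_cst.
  apply/gtr0_cvgV0; first by near=> N; rewrite ltr0n; near: N; exact: nbhs_infty_gt.
  exact: cvgr_idn.
have var : alpha ^+ 2 * (N%:R ^+ 2 * residual_variance (T / N%:R) N) @[N --> \oo] -->
    alpha ^+ 2 * (T ^+ 2 * error_constant T).
  apply: cvgM; first exact: cvg_cst.
  apply/cvgrPdist_le => e e0; near=> N.
  have N0 : (0 < N)%N by near: N; exact: nbhs_infty_gt.
  have h1 : T / N%:R < 1 by near: N; exact: (cvgr_lt (0 : R) harm _ ltr01).
  have h2 : T / N%:R < e / (T ^+ 2 * (C + 1)).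
    near: N; apply: (cvgr_lt (0 : R) harm).
    by rewrite divr_gt0// mulr_gt0 ?exprn_gt0// ltr_wpDl.
  have := HC N N0 (ltW h1).
  set h := T / N%:R in h1 h2 *; set V := residual_variance h N.
  have NR0 : 0 < N%:R :> R by rewrite ltr0n.
  have h0 : 0 < h by rewrite divr_gt0.
  have NhT : N%:R * h = T by rewrite /h mulrC divfK// gt_eqF.
  move=> HV.
  have -> : T ^+ 2 * error_constant T - N%:R ^+ 2 * V =
    - (N%:R ^+ 2 * (V - error_constant T * h ^+ 2)) by rewrite -NhT; ring.
  rewrite normrN normrM ger0_norm ?sqr_ge0//.
  apply: (@le_trans _ _ (N%:R ^+ 2 * (C * h ^+ 3))); first by rewrite ler_wpM2l ?sqr_ge0.
  have -> : N%:R ^+ 2 * (C * h ^+ 3) = T ^+ 2 * C * h by rewrite -NhT; ring.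
  move: h2; rewrite ltr_pdivlMr; last by rewrite mulr_gt0 ?exprn_gt0// ltr_wpDl.
  move=> h2; apply: le_trans (ltW h2).
  by rewrite mulrC ler_wpM2l ?(ltW h0)// ler_wpM2l ?sqr_ge0//; lra.
rewrite -mulrA.
have := cvg_comp _ Num.sqrt var (@sqrt_continuous R _).
apply: cvg_trans; apply: near_eq_cvg; near=> N.
by rewrite /= E//; near: N; exact: nbhs_infty_gt.
Unshelve. all: by end_near. Qed.

End CentralLimit.

Theorem mainTheorem5 (R : realType) (d : measure_display)
    (Omega : measurableType d) (P : probability Omega R)
    (alpha T : R) (x0 : 'cV[R]_2)
    (W : R -> {RV P >-> R}) (X : R -> Omega -> 'cV[R]_2)
    (alpha_gt0 : 0 < alpha) (T_gt0 : 0 < T)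
    (W_brownian : is_brownian_motion W)
    (X_solution : is_oscillator_solution alpha T x0 W X) :
  let e := pc_error alpha T x0 W X in
  (exists C : R, \forall N \near \oo,
    (`| 'V_P[e N] - (alpha ^+ 2 * error_constant T * (T / N%:R) ^+ 2)%:E |
     <= (C * (T / N%:R) ^+ 3)%:E)%E)
  /\
  cvg_in_distribution P
    (fun N w => N%:R * e N w - fine 'E_P[fun w' => (N%:R * e N w')%R]%E)
    (normal_prob 0 (Num.sqrt (alpha ^+ 2 * T ^+ 2 * error_constant T))).
Proof.
move=> e; split.
  have [C C0 HC] := residual_variance_expansion T T_gt0.
  exists (alpha ^+ 2 * C); near=> N.
  have N0 : (0 < N)%N by near: N; exact: nbhs_infty_gt.
  have h1 : T / N%:R <= 1.
    rewrite ler_pdivrMr ?ltr0n// mul1r; near: N; exact: nbhs_infty_ger.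
  rewrite (pc_error_variance P _ _ _ _ _ T_gt0 W_brownian X_solution N N0).
  rewrite -EFinB lee_fin -[_ * error_constant T * _]mulrA -mulrBr normrM.
  by rewrite ger0_norm ?sqr_ge0// -[leRHS]mulrA ler_wpM2l ?sqr_ge0// HC.
have gZ := pc_error_gaussian P _ _ _ _ _ T_gt0 W_brownian X_solution.
have me N : measurable_fun [set: Omega] (e N) := measurable_pc_error P _ _ _ _ _ T_gt0 X_solution N.
split.
  by move=> N; apply: measurable_funB => //; exact: measurable_funM.
move=> f cf [M0 [_ fM0]].
(* Boundedness provides a bound for every number strictly above [M0]. *)
pose M := M0 + 1.
have fM x : `|f x| <= M by apply: fM0 => //; rewrite ltrDl.
pose s := Num.sqrt (alpha ^+ 2 * T ^+ 2 * error_constant T).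
have s0 : 0 < s by rewrite sqrtr_gt0 !mulr_gt0 ?exprn_gt0 ?error_constant_gt0.
rewrite (normal_prob_integral s M f s0 cf fM).
have mf : measurable_fun [set: R] f by exact: continuous_measurable_fun.
have lim : (\int[normal_prob 0 1]_x (f (N%:R * error_sd alpha T N * x))%:E)%E @[N --> \oo] -->
    (\int[normal_prob 0 1]_x (f (s * x))%:E)%E.
  apply: (@bounded_convergence _ _ (measurableTypeR R) (normal_prob 0 1)
    (fun N x => f (N%:R * error_sd alpha T N * x)) (fun x => f (s * x)) M).
  - by move=> N; exact: (measurableT_comp mf (measurable_scale _)).
  - exact: (measurableT_comp mf (measurable_scale _)).
  - by move=> N x; exact: fM.
  - apply: aeW => x; apply: (cvg_comp (fun N => N%:R * error_sd alpha T N * x)); last exact: cf.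
    by apply: cvgM; [exact: scaled_sd_cvg|exact: cvg_cst].
(* For N > 0 the expectation equals the Gaussian integral with scale N [error_sd], so only the
   scales have to converge. *)
apply: cvg_trans lim; apply: near_eq_cvg; near=> N.
have N0 : (0 < N)%N by near: N; exact: nbhs_infty_gt.
have -> : 'E_P[fun w' => (N%:R * e N w')%R]%E = (N%:R * error_mean T x0 N)%:E.
  rewrite -(weakly_gaussian_expectation P _ _ N%:R (N%:R * error_mean T x0 N) (gZ N N0)).
  by congr expectation; apply/funext => w; rewrite -mulrDr subrK.
rewrite unlock /=.
have [_ gN] := gZ N N0.
transitivity (\int[P]_w (f (N%:R * (e N w - error_mean T x0 N)))%:E)%E; last first.
  by apply: eq_integral => w _; rewrite /= -mulrBr.
apply/esym; under [RHS]eq_integral do rewrite -mulrA.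
apply: (gN (fun x => f (N%:R * x)) M) => // x.
apply: (cvg_comp (fun x => N%:R * x)); last exact: cf.
by apply: cvgM; [exact: cvg_cst|exact: cvg_id].
Unshelve. all: by end_near. Qed.
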